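(* Let $0<p\leq q$ and $r\geq0$ be real numbers. The following are equivalent: (1) For every $n\geq1$ and all positive semidefinite $A,B\in M_n(\mathbb C)$, one has \[ A^{r+q}B^q\succ_{\log}A^r\bigl(A^{p/2}B^pA^{p/2}\bigr)^{q/p}. \] (2) Either \[ p\leq q\leq2p, \] or \[ q>2p\quad\text{and}\quad 0\leq r\leq\frac{pq}{q-2p}. \] Moreover, if $q>2p$ and $r>pq/(q-2p)$, then even the corresponding trace inequality \[ \operatorname{Tr}A^{r+q}B^q\geq\operatorname{Tr}A^r\bigl(A^{p/2}B^pA^{p/2}\bigr)^{q/p} \] fails for some positive definite $A,B\in M_3(\mathbb C)$.
   Context: Powers of positive semidefinite matrices are taken by the functional calculus. For an $n\times n$ complex matrix $X$ with nonnegative real eigenvalues, $\lambda_1(X)\geq\cdots\geq\lambda_n(X)\geq0$ denote its eigenvalues counted with multiplicity. For two such matrices, $X\succ_{\log}Y$ means \[ \prod_{j=1}^k\lambda_j(Y)\leq\prod_{j=1}^k\lambda_j(X)\quad(1\leq k<n),\qquad \det X=\det Y . \] The products in the claim need not be Hermitian, but they have nonnegative real eigenvalues, and the log-majorization is understood in terms of these eigenvalues. *)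

(* Defs.v *)
From mathcomp Require Import all_boot all_order all_algebra.
From mathcomp Require Import spectral sesquilinear complex.
From mathcomp Require Import reals exp.

Set Implicit Arguments.
Unset Strict Implicit.
Unset Printing Implicit Defensive.

Import Order.TTheory GRing.Theory Num.Theory.
Local Open Scope ring_scope.
Local Open Scope sesquilinear_scope.
Local Open Scope complex_scope.

Definition psdmx (R : realType) (n : nat) (A : 'M[R[i]]_n) : Prop :=
  A \is hermsymmx /\ forall x : 'cV[R[i]]_n, 0 <= (x^t* *m A *m x) 0 0.

Definition pdmx (R : realType) (n : nat) (A : 'M[R[i]]_n) : Prop :=
  A \is hermsymmx /\
  forall x : 'cV[R[i]]_n, x != 0 -> 0 < (x^t* *m A *m x) 0 0.

(* Functional calculus for t |-> t `^ s, through the spectral decomposition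
   A = U^-1 *m diag_mx d *m U with U unitary; meaningful for A positive
   semidefinite, where d has nonnegative real entries. Since 0 `^ 0 = 1, the
   zeroth power is the identity matrix, including for singular A. *)
Definition mxpowR (R : realType) (n : nat) (A : 'M[R[i]]_n) (s : R) :
    'M[R[i]]_n :=
  invmx (spectralmx A)
    *m diag_mx (map_mx (fun z => (complex.Re z `^ s)%:C) (spectral_diag A))
    *m spectralmx A.

(* The roots of the characteristic polynomial, repeated according to algebraic
   multiplicity. The order on R[i] is partial, and total on the reals, so
   the sequence is nonincreasing as soon as all the eigenvalues are real. *)
Definition eigenvalues (R : realType) (n : nat) (X : 'M[R[i]]_n) : seq R[i] :=
  sort >=%R (sval (closed_field_poly_normal (char_poly X))).

(* lambda X j is the eigenvalue written $\lambda_{j+1}(X)$ in one-based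
   numbering. *)
Definition lambda (R : realType) (n : nat) (X : 'M[R[i]]_n) (j : nat) : R[i] :=
  nth 0 (eigenvalues X) j.

(* log_major X Y is X \succ_{log} Y: it is X that dominates. *)
Definition log_major (R : realType) (n : nat) (X Y : 'M[R[i]]_n) : Prop :=
  (forall k : nat, (1 <= k < n)%N ->
     \prod_(j < k) lambda Y j <= \prod_(j < k) lambda X j) /\
  \det X = \det Y.

Lemma char_poly_eigenvalues (R : realType) (n : nat) (X : 'M[R[i]]_n) :
  char_poly X = \prod_(z <- eigenvalues X) ('X - z%:P).
Proof.
rewrite /eigenvalues; case: closed_field_poly_normal => s /= eq_s.
rewrite (perm_big s) ?perm_sort //=.
by rewrite {1}eq_s (monicP (char_poly_monic X)) scale1r.
Qed.

Lemma size_eigenvalues (R : realType) (n : nat) (X : 'M[R[i]]_n) :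
  size (eigenvalues X) = n.
Proof.
by apply/succn_inj; rewrite -(size_char_poly X) char_poly_eigenvalues
  size_prod_XsubC.
Qed.

Lemma mem_eigenvalues (R : realType) (n : nat) (X : 'M[R[i]]_n) (z : R[i]) :
  (z \in eigenvalues X) = eigenvalue X z.
Proof.
by rewrite eigenvalue_root_char char_poly_eigenvalues root_prod_XsubC.
Qed.

Lemma psd_diag (R : realType) (n : nat) (A : 'M[R[i]]_n) :
  psdmx A -> forall i, 0 <= spectral_diag A 0 i.
Proof.
case=> hA pA i; have nA := hermitian_normalmx hA.
have /orthomx_spectralP eA := nA; have uU := spectral_unitarymx A.
set U := spectralmx A in eA uU.
have := pA (U^t* *m delta_mx i 0); rewrite {1}eA invmx_unitary //.
rewrite trmx_mul map_mxM /= trmxCK !mulmxA !(mulmxtVK _ uU) trmx_delta.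

rewrite map_delta_mx.
by rewrite -rowE row_diag_mx -scalemxAl mul_delta_mx !mxE !eqxx mulr1.
Qed.

Lemma conj_diag_psd (R : realType) (n : nat) (U : 'M[R[i]]_n) (d : 'rV[R[i]]_n) :
  U \is unitarymx -> (forall i, 0 <= d 0 i) ->
  psdmx (invmx U *m diag_mx d *m U).
Proof.
move=> uU d0; rewrite invmx_unitary //; split.
  apply/is_hermitianmxP; rewrite expr0 scale1r !trmx_mul !map_mxM /= trmxCK.
  rewrite tr_diag_mx map_diag_mx mulmxA; congr (_ *m diag_mx _ *m _).
  by apply/rowP=> i; rewrite !mxE; apply/esym/geC0_conj.
move=> x; set y := U *m x.
have -> : x^t* *m (U^t* *m diag_mx d *m U) *m x = y^t* *m (diag_mx d *m y).
  by rewrite /y trmx_mul map_mxM !mulmxA.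
rewrite mxE sumr_ge0 // => i _; rewrite mul_diag_mx !mxE mulrCA.
by rewrite mulr_ge0 // mulrC mul_conjC_ge0.
Qed.

Lemma mxpowR_psd (R : realType) (n : nat) (A : 'M[R[i]]_n) (s : R) :
  psdmx (mxpowR A s).
Proof.
apply: conj_diag_psd => [|i]; first exact: spectral_unitarymx.
by rewrite mxE lecR powR_ge0.
Qed.

Lemma psd_form_eq0 (R : realType) (n : nat) (A : 'M[R[i]]_n) (v : 'rV[R[i]]_n) :
  psdmx A -> (v *m A *m v^t*) 0 0 = 0 -> v *m A = 0.
Proof.
move=> pA; have d0 := psd_diag pA.
have /orthomx_spectralP eA := hermitian_normalmx pA.1.
have uU := spectral_unitarymx A; rewrite (invmx_unitary uU) in eA.
set U := spectralmx A in eA uU; set d := spectral_diag A in eA d0.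
rewrite eA; clearbody U d; clear eA pA A.
pose y := v *m U^t*.
have -> : v *m (U^t* *m diag_mx d *m U) *m v^t* = y *m diag_mx d *m y^t*.
  by rewrite /y trmx_mul map_mxM /= trmxCK !mulmxA.
move=> y0; suff -> : v *m (U^t* *m diag_mx d *m U) = y *m diag_mx d *m U.
  suff -> : y *m diag_mx d = 0 by rewrite mul0mx.
  rewrite mul_mx_diag; apply/rowP=> j; rewrite !mxE.
  move: y0; rewrite mul_mx_diag mxE => /psumr_eq0P/(_ j isT) y0.
  apply/eqP; move: y0; rewrite !mxE mulrAC => /(_ _)/eqP; rewrite mulf_eq0.
  rewrite mul_conjC_eq0 -mulf_eq0; apply=> i _.
  by rewrite !mxE mulrAC mulr_ge0 ?mul_conjC_ge0.
by rewrite /y !mulmxA.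
Qed.

Lemma psd_mul_eigenvalues (R : realType) (n : nat) (A B : 'M[R[i]]_n) :
  psdmx A -> psdmx B -> all (>= 0) (eigenvalues (A *m B)).
Proof.
move=> pA pB; apply/allP => z; rewrite mem_eigenvalues => /eigenvalueP[v vAB v0].
have hA : A^t* = A.
  by have /is_hermitianmxP := pA.1; rewrite expr0 scale1r => /esym.
have := pB.2 ((v *m A)^t*); rewrite trmxCK trmx_mul map_mxM /= hA !mulmxA.
rewrite -(mulmxA v A B) vAB -!scalemxAl mxE.
have := pA.2 (v^t*); rewrite trmxCK le_eqVlt => /predU1P[/esym vA0 _|vA_gt0].
  have := psd_form_eq0 pA vA0 => vA; move: vAB; rewrite mulmxA vA mul0mx.
  by move=> /esym/eqP; rewrite scaler_eq0 (negbTE v0) orbF => /eqP->.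
by rewrite pmulr_lge0.
Qed.

(* Main.v *)
(* Replacing A, B by their p-th powers, assume p = 1 and put
   X = A^(1/2) B A^(1/2). Exterior powers (compound matrices) reduce the
   majorization to: if A^((r+q)/2) B^q A^((r+q)/2) <= 1 then
   A^(r/2) X^q A^(r/2) <= 1. By Cordes' inequality the hypothesis gives
   A^a B^b A^a <= 1 whenever 2 a q = b (r + q) and 0 <= b <= q.
   - If q <= 2, then X^q = T Y^(q-1) T^* with T = A^(1/2) B^(1/2) and
     Y = B^(1/2) A B^(1/2); Cordes' inequality for the exponent q - 1 bounds
     Y^(q-1) by a power of B.
   - If q >= 2, then P(s): A^(rs/2q) X^s A^(rs/2q) <= 1 holds for s = 1, passes
     to smaller exponents, and P(s) implies P(s+2) because X^(s+2) = X X^s X and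
     A^(1/2) X^s A^(1/2) <= A^(1 - rs/q). The exponent 1 - rs/q is nonnegative
     for all s <= q - 2 exactly when r (q - 2) <= q.
   For r (q - 2) > q, explicit 3 x 3 matrices with one large eigenvalue N of A
   make the ratio of the two traces, hence of the largest eigenvalues, blow up
   as N grows. *)

Require Import Defs.
From HB Require Import structures.
From mathcomp Require Import all_boot all_order all_algebra all_fingroup.
From mathcomp Require Import spectral sesquilinear complex.
From mathcomp Require Import reals exp.
From mathcomp Require Import ring lra.

Set Implicit Arguments.
Unset Strict Implicit.
Unset Printing Implicit Defensive.

Import Order.TTheory GRing.Theory Num.Theory.
Local Open Scope ring_scope.
Local Open Scope sesquilinear_scope.

(** * The Loewner order and the functional calculus *)

Section Adjoint.
Variable C : numClosedFieldType.
Implicit Types n m k : nat.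

Lemma trmxC_mul n m k (A : 'M[C]_(n, m)) (B : 'M[C]_(m, k)) :
  (A *m B)^t* = B^t* *m A^t*.
Proof. by rewrite trmx_mul map_mxM. Qed.

Lemma trmxC1 n : (1%:M : 'M[C]_n)^t* = 1%:M.
Proof. by rewrite trmx1 map_mx1. Qed.

Lemma unitarymxK n (U : 'M[C]_n) : U \is unitarymx -> U^t* *m U = 1%:M.
Proof. by move=> /unitarymxP/mulmx1C. Qed.

Lemma unitarymx_mul n (U : 'M[C]_n) : U \is unitarymx -> U *m U^t* = 1%:M.
Proof. by move=> /unitarymxP. Qed.

Definition qform n (A : 'M[C]_n) (x : 'cV[C]_n) : C := (x^t* *m A *m x) 0 0.

(** Over [R[i]] this unfolds to [psdmx], so the final theorem follows by conversion. *)
Definition psd n (A : 'M[C]_n) : Prop :=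
  A \is hermsymmx /\ forall x : 'cV[C]_n, 0 <= qform A x.

Lemma psdP n (A : 'M[C]_n) :
  psd A <-> A^t* = A /\ forall x : 'cV[C]_n, 0 <= qform A x.
Proof.
rewrite /psd; split=> -[hA pA]; split=> //.
  by have /is_hermitianmxP := hA; rewrite expr0 scale1r => /esym.
by apply/is_hermitianmxP; rewrite expr0 scale1r hA.
Qed.

Lemma psd_trmxC n (A : 'M[C]_n) : psd A -> A^t* = A.
Proof. by case/psdP. Qed.

Lemma qform_conj n m (A : 'M[C]_n) (T : 'M[C]_(n, m)) (x : 'cV[C]_m) :
  qform (T^t* *m A *m T) x = qform A (T *m x).
Proof. by rewrite /qform trmxC_mul !mulmxA. Qed.

Lemma qformD n (A B : 'M[C]_n) x : qform (A + B) x = qform A x + qform B x.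
Proof. by rewrite /qform mulmxDr mulmxDl mxE. Qed.

Lemma qformZ n (A : 'M[C]_n) a x : qform (a *: A) x = a * qform A x.
Proof. by rewrite /qform -scalemxAr -scalemxAl mxE. Qed.

Lemma qform_eigen n (A : 'M[C]_n) x a :
  A *m x = a *: x -> qform A x = a * qform 1%:M x.
Proof. by move=> eA; rewrite /qform -mulmxA eA mulmx1 -scalemxAr mxE. Qed.

Lemma qform1E n (x : 'cV[C]_n) : qform 1%:M x = \sum_i `|x i 0| ^+ 2.
Proof.
rewrite /qform mulmx1 mxE; apply: eq_bigr => i _.
by rewrite !mxE mulrC -normCK.
Qed.

Lemma qform1_ge0 n (x : 'cV[C]_n) : 0 <= qform 1%:M x.
Proof. by rewrite qform1E sumr_ge0 // => i _; rewrite exprn_ge0. Qed.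

Lemma qform1_gt0 n (x : 'cV[C]_n) : x != 0 -> 0 < qform 1%:M x.
Proof.
move=> x0; rewrite lt_def qform1_ge0 andbT; apply: contraNneq x0.
rewrite qform1E => /psumr_eq0P x0; apply/eqP/colP=> i; rewrite mxE.
by apply/eqP; rewrite -normr_eq0 -sqrf_eq0 x0 // => j _; rewrite exprn_ge0.
Qed.

Lemma psd0 n : psd (0 : 'M[C]_n).
Proof.
apply/psdP; split=> [|x]; first by rewrite trmx0 map_mx0.
by rewrite /qform mulmx0 mul0mx mxE.
Qed.

Lemma psd1 n : psd (1%:M : 'M[C]_n).
Proof. by apply/psdP; split=> [|x]; rewrite ?trmxC1 ?qform1_ge0. Qed.

Lemma psdD n (A B : 'M[C]_n) : psd A -> psd B -> psd (A + B).
Proof.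
move=> /psdP[hA pA] /psdP[hB pB]; apply/psdP; split=> [|x].
  by rewrite linearD /= map_mxD hA hB.
by rewrite qformD addr_ge0.
Qed.

Lemma psdZ n (A : 'M[C]_n) a : 0 <= a -> psd A -> psd (a *: A).
Proof.
move=> a0 /psdP[hA pA]; apply/psdP; split=> [|x].
  rewrite -[in RHS]hA -[in RHS](geC0_conj a0).
  by apply/matrixP=> i j; rewrite !mxE rmorphM.
by rewrite qformZ mulr_ge0.
Qed.

Lemma psd_conj n m (A : 'M[C]_n) (T : 'M[C]_(n, m)) :
  psd A -> psd (T^t* *m A *m T).
Proof.
move=> /psdP[hA pA]; apply/psdP; split=> [|x]; last by rewrite qform_conj.
by rewrite !trmxC_mul trmxCK hA mulmxA.
Qed.

Lemma psd_gram n m (T : 'M[C]_(n, m)) : psd (T^t* *m T).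
Proof. by have := psd_conj T (@psd1 n); rewrite mulmx1. Qed.

Definition loewner n (A B : 'M[C]_n) : Prop := psd (B - A).
Local Notation "A ⪯ B" := (loewner A B) (at level 70).

Lemma loewner_refl n (A : 'M[C]_n) : A ⪯ A.
Proof. by rewrite /loewner subrr; apply: psd0. Qed.

Lemma loewner_trans n (A B D : 'M[C]_n) : A ⪯ B -> B ⪯ D -> A ⪯ D.
Proof. by move=> h1 h2; have := psdD h2 h1; rewrite addrA subrK. Qed.

Lemma loewner_conj n m (A B : 'M[C]_n) (T : 'M[C]_(n, m)) :
  A ⪯ B -> T^t* *m A *m T ⪯ T^t* *m B *m T.
Proof. by move=> /(psd_conj T); rewrite mulmxBr mulmxBl. Qed.

Lemma loewnerZ n (A B : 'M[C]_n) a : 0 <= a -> A ⪯ B -> a *: A ⪯ a *: B.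
Proof. by move=> a0 /(psdZ a0); rewrite scalerBr. Qed.

Lemma loewner_form n (A B : 'M[C]_n) x : A ⪯ B -> qform A x <= qform B x.
Proof.
by case/psdP=> _ /(_ x); rewrite -scaleN1r qformD qformZ mulN1r subr_ge0.
Qed.

End Adjoint.
Notation "A ⪯ B" := (loewner A B) (at level 70).

(* [C] stands for [R[i]]: only its order, its conjugation and the copy of [R]
   inside it are used. *)
Record real_embedding (R : realType) (C : numClosedFieldType) :=
  RealEmbedding {
    embed :> {rmorphism R -> C};
    real_part : C -> R;
    embedK : cancel embed real_part;
    real_partK : {in Num.real, cancel real_part embed};
    ler_embed : {mono embed : x y / x <= y} }.

(** Locked to keep the chosen spectral decomposition from unfolding; the lemmas below reach it
    through [psd_specE]. *)
HB.lock Definition mxpow (R : realType) (C : numClosedFieldType)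
    (iota : real_embedding R C) (n : nat) (A : 'M[C]_n) (s : R) : 'M[C]_n :=
  invmx (spectralmx A)
    *m diag_mx
         (map_mx (fun z => iota (real_part iota z `^ s)) (spectral_diag A))
    *m spectralmx A.

(** * Real powers through arbitrary unitary diagonalizations *)

Section Calculus.
Variables (R : realType) (C : numClosedFieldType) (iota : real_embedding R C).
Local Notation re := (real_part iota).
Implicit Types (n m k : nat) (s t c : R).

Local Notation mxpow := (mxpow iota).
Local Notation cmx := (map_mx iota).

Definition spectral_mx n (U : 'M[C]_n) (d : 'rV[R]_n) : 'M[C]_n :=
  U^t* *m diag_mx (cmx d) *m U.

Local Notation spec := spectral_mx.

Lemma iota_inj : injective iota. Proof. exact: can_inj (embedK iota). Qed.

Lemma iota_ge0 c : (0 <= iota c) = (0 <= c).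
Proof. by rewrite -(ler_embed iota) rmorph0. Qed.

Lemma iota_conj c : (iota c)^* = iota c.
Proof.
case: (leP 0 c) => c0; first by rewrite geC0_conj // iota_ge0.
rewrite -[c]opprK (rmorphN iota) [LHS]rmorphN; congr (- _); apply: geC0_conj.
by rewrite iota_ge0 oppr_ge0 ltW.
Qed.

Lemma spec_form n (U : 'M[C]_n) d x :
  qform (spec U d) x = \sum_i iota (d 0 i) * `|(U *m x) i 0| ^+ 2.
Proof.
rewrite /spectral_mx qform_conj /qform -mulmxA mxE; move: (U *m x) => y.
apply: eq_bigr => i _.
by rewrite mul_diag_mx !mxE mulrCA normCK [y i 0 * _]mulrC.
Qed.

Lemma spec_trmxC n (U : 'M[C]_n) d : (spec U d)^t* = spec U d.
Proof.
rewrite /spectral_mx !trmxC_mul trmxCK tr_diag_mx map_diag_mx mulmxA.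
congr (_ *m diag_mx _ *m _); apply/rowP=> i; rewrite !mxE; exact: iota_conj.
Qed.

Lemma spec_psd n (U : 'M[C]_n) (d : 'rV[R]_n) :
  (forall i, 0 <= d 0 i) -> psd (spec U d).
Proof.
move=> d0; apply/psdP; split=> [|x]; first exact: spec_trmxC.
rewrite spec_form sumr_ge0 // => i _.
by rewrite mulr_ge0 ?iota_ge0 ?exprn_ge0.
Qed.

Lemma psd_specE n (A : 'M[C]_n) : psd A ->
  exists (U : 'M[C]_n) (d : 'rV[R]_n),
  [/\ U \is unitarymx, forall i, 0 <= d 0 i, A = spec U d &
     forall s, mxpow A s = spec U (map_mx ((@powR R)^~ s) d)].
Proof.
move=> pA; have /orthomx_spectralP := hermitian_normalmx pA.1.
have := spectral_unitarymx A; rewrite mxpow.unlock.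
move: (spectralmx A) (spectral_diag A) => U z uU eA.
have z0 i : 0 <= z 0 i.
  (* The quadratic form of A at the i-th column of [U^t*] is the eigenvalue [z 0 i]. *)
  have := (psd_conj (U^t*) pA).2 (delta_mx i 0).
  rewrite trmxCK eA (invmx_unitary uU) !mulmxA unitarymx_mul // mul1mx.
  rewrite -mulmxA unitarymx_mul // mulmx1 /qform trmx_delta map_delta_mx.
  by rewrite -rowE row_diag_mx -scalemxAl mul_delta_mx !mxE !eqxx mulr1.
exists U, (map_mx re z).
have ez : cmx (map_mx re z) = z.
  by apply/rowP=> i; rewrite !mxE real_partK // ger0_real.
split=> [|i||s]; first exact: uU.
- by rewrite mxE -iota_ge0 real_partK ?ger0_real.
- by rewrite {1}eA /spectral_mx ez (invmx_unitary uU).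
- rewrite /spectral_mx (invmx_unitary uU); congr (_ *m diag_mx _ *m _).
  by apply/rowP=> i; rewrite !mxE.
Qed.

(** Entrywise, N i j vanishes unless d i = e j, and then f takes the same value at both. *)
Lemma diag_intertwine n m (d : 'rV[R]_n) (e : 'rV[R]_m)
    (N : 'M[C]_(n, m)) (f : R -> R) :
  diag_mx (cmx d) *m N = N *m diag_mx (cmx e) ->
  diag_mx (cmx (map_mx f d)) *m N = N *m diag_mx (cmx (map_mx f e)).
Proof.
move=> /matrixP eN; apply/matrixP=> i j; move/(_ i j): eN.
rewrite !mul_diag_mx !mul_mx_diag !mxE ![_ * N i j]mulrC => /eqP.
rewrite -subr_eq0 -mulrBr mulf_eq0 => /orP[/eqP->|]; first by rewrite !mul0r.
by rewrite subr_eq0 => /eqP/iota_inj ->.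
Qed.

Lemma spec_intertwine n m (U : 'M[C]_n) (V : 'M[C]_m) d e
    (M : 'M[C]_(n, m)) (f : R -> R) :
  U \is unitarymx -> V \is unitarymx ->
  spec U d *m M = M *m spec V e ->
  spec U (map_mx f d) *m M = M *m spec V (map_mx f e).
Proof.
move=> uU uV eM; set N := U *m M *m V^t*.
have /(@diag_intertwine _ _ _ _ _ f) eN :
    diag_mx (cmx d) *m N = N *m diag_mx (cmx e).
  have := congr1 (fun Z => U *m Z *m V^t*) eM.
  rewrite /spectral_mx /N !mulmxA (unitarymx_mul uU) mul1mx => ->.
  by rewrite -!mulmxA (unitarymx_mul uV) mulmx1.
have eM' : M = U^t* *m N *m V.
  by rewrite /N !mulmxA unitarymxK // mul1mx -mulmxA unitarymxK // mulmx1.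
transitivity (U^t* *m (diag_mx (cmx (map_mx f d)) *m N) *m V).
  by rewrite /spectral_mx {1}eM' !mulmxA mulmxtVK.
by rewrite eN /spectral_mx /N !mulmxA unitarymxK // mul1mx.
Qed.

(** Intertwining two diagonalizations of one matrix by the identity shows that powers do not depend
    on the diagonalization. *)
Lemma mxpow_spec n (U : 'M[C]_n) (d : 'rV[R]_n) s : U \is unitarymx ->
  (forall i, 0 <= d 0 i) ->
  mxpow (spec U d) s = spec U (map_mx ((@powR R)^~ s) d).
Proof.
move=> uU d0; have [V [e [uV _ eV eP]]] := psd_specE (spec_psd U d0).
rewrite eP -[LHS]mulmx1 -[RHS]mul1mx; apply: spec_intertwine => //.
by rewrite mulmx1 mul1mx -eV.
Qed.

Lemma mxpow_intertwine n m (A : 'M[C]_n) (B : 'M[C]_m) (M : 'M[C]_(n, m)) s :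
  psd A -> psd B -> A *m M = M *m B -> mxpow A s *m M = M *m mxpow B s.
Proof.
move=> /psd_specE[U [d [uU _ eA ->]]] /psd_specE[V [e [uV _ eB ->]]].
by rewrite eA eB; apply: spec_intertwine.
Qed.

Lemma mxpow_psd n (A : 'M[C]_n) s : psd A -> psd (mxpow A s).
Proof.
move=> /psd_specE[U [d [uU _ _ ->]]]; apply: spec_psd => i.
by rewrite mxE powR_ge0.
Qed.

Lemma mxpow_trmxC n (A : 'M[C]_n) s : psd A -> (mxpow A s)^t* = mxpow A s.
Proof. by move=> /(mxpow_psd s)/psd_trmxC. Qed.

Lemma specM n (U : 'M[C]_n) d e : U \is unitarymx ->
  spec U d *m spec U e = spec U (\row_i (d 0 i * e 0 i)).
Proof.
move=> uU; rewrite /spectral_mx !mulmxA mulmxtVK // -[X in X *m U]mulmxA mulmx_diag.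
by congr (_ *m diag_mx _ *m _); apply/rowP=> i; rewrite !mxE rmorphM.
Qed.

Lemma mxpow0 n (A : 'M[C]_n) : psd A -> mxpow A 0 = 1%:M.
Proof.
move=> /psd_specE[U [d [uU _ _ ->]]]; rewrite /spec.
set D := diag_mx _; suff -> : D = 1%:M by rewrite mulmx1 unitarymxK.
rewrite /D -diag_const_mx; congr diag_mx; apply/rowP=> i.
by rewrite !mxE powRr0 rmorph1.
Qed.

Lemma mxpow1 n (A : 'M[C]_n) : psd A -> mxpow A 1 = A.
Proof.
move=> /psd_specE[U [d [uU d0 eA ->]]]; rewrite eA; congr spectral_mx.
by apply/rowP=> i; rewrite !mxE powRr1.
Qed.

(** The law breaks for x = 0 when s + t = 0 but s != 0; nonnegative exponents with sum 0 both
    vanish, which excludes this. *)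
Lemma powRD_ge0 (x s t : R) : 0 <= s -> 0 <= t -> x `^ (s + t) = x `^ s * x `^ t.
Proof.
move=> s0 t0; have [st|st] := eqVneq (s + t) 0; last first.
  by rewrite powRD // (negbTE st).
have [-> ->] : s = 0 /\ t = 0 by split; lra.
by rewrite addr0 powRr0 mulr1.
Qed.

Lemma mxpowD n (A : 'M[C]_n) s t : psd A -> 0 <= s -> 0 <= t ->
  mxpow A (s + t) = mxpow A s *m mxpow A t.
Proof.
move=> /psd_specE[U [d [uU _ _ eA]]] s0 t0; rewrite !eA specM //; congr spectral_mx.
by apply/rowP=> i; rewrite !mxE powRD_ge0.
Qed.

Lemma mxpow_mxpow n (A : 'M[C]_n) s t : psd A ->
  mxpow (mxpow A s) t = mxpow A (s * t).
Proof.
move=> /psd_specE[U [d [uU _ _ eA]]].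
rewrite (eA s) (eA (s * t)) (mxpow_spec _ uU) => [|i].
  by congr spectral_mx; apply/rowP=> i; rewrite !mxE powRrM.
by rewrite mxE powR_ge0.
Qed.

Lemma mxpowZ n (A : 'M[C]_n) c s : psd A -> 0 <= c ->
  mxpow (iota c *: A) s = iota (c `^ s) *: mxpow A s.
Proof.
have eZ U (d : 'rV[R]_n) a : iota a *: spec U d = spec U (a *: d) :> 'M[C]_n.
  rewrite /spectral_mx scalemxAl scalemxAr; congr (_ *m _ *m _).
  by apply/matrixP=> i j; rewrite !mxE rmorphM mulrnAr.
move=> /psd_specE[U [d [uU d0 eA eP]]] c0.
rewrite eP eA !eZ mxpow_spec // => [|i].
  by congr spectral_mx; apply/rowP=> i; rewrite !mxE powRM.
by rewrite mxE mulr_ge0.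
Qed.

End Calculus.

(** * Cordes' inequality *)

Section Cordes.
Variables (R : realType) (C : numClosedFieldType) (iota : real_embedding R C).
Local Notation re := (real_part iota).
Implicit Types (n m k : nat) (s t c : R).
Local Notation mxpow := (mxpow iota).
Local Notation spec := (spectral_mx iota).

Lemma loewner_conjh n (A B T : 'M[C]_n) :
  psd T -> A ⪯ B -> T *m A *m T ⪯ T *m B *m T.
Proof. by move=> /psd_trmxC hT /(loewner_conj T); rewrite hT. Qed.

Lemma spec_loewner_scalar n (U : 'M[C]_n) (d : 'rV[R]_n) c :
  U \is unitarymx -> (forall i, d 0 i <= c) -> spec U d ⪯ (iota c)%:M.
Proof.
move=> uU dc; rewrite /loewner.
have -> : (iota c)%:M - spec U d = spec U (const_mx c - d).
  rewrite /spectral_mx map_mxB map_const_mx linearB /= mulmxBr mulmxBl.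
  by rewrite diag_const_mx mul_mx_scalar -scalemxAl unitarymxK // scalemx1.
by apply: spec_psd => i; rewrite !mxE subr_ge0.
Qed.

Lemma spec_eigenvector n (U : 'M[C]_n) (d : 'rV[R]_n) i : U \is unitarymx ->
  exists2 x : 'cV[C]_n, x != 0 & spec U d *m x = iota (d 0 i) *: x.
Proof.
move=> uU; exists (U^t* *m delta_mx i 0).
  apply: contraTneq isT => /(congr1 (mulmx U)); rewrite mulmxA unitarymx_mul //.
  rewrite mul1mx mulmx0 => /colP/(_ i)/eqP; rewrite !mxE !eqxx /=.
  by rewrite oner_eq0.
rewrite /spectral_mx -!mulmxA (mulmxA U) unitarymx_mul // mul1mx scalemxAr.
by congr (_ *m _); rewrite -colE; apply/colP=> j; rewrite !mxE eq_sym;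
  case: eqP => [->|]; rewrite ?mulr0n ?mulr0 ?eqxx ?mulr1.
Qed.

Lemma loewner_scalarP n (A : 'M[C]_n) c : psd A ->
  (forall (x : 'cV[C]_n) t, x != 0 -> A *m x = iota t *: x -> t <= c) ->
  A ⪯ (iota c)%:M.
Proof.
move=> /(psd_specE iota)[U [d [uU _ -> _]]] ec.
apply: spec_loewner_scalar => // i.
by have [x x0 ex] := spec_eigenvector d i uU; apply: ec ex.
Qed.

Lemma loewner_scalar_eigen n (A : 'M[C]_n) c (x : 'cV[C]_n) t :
  A ⪯ (iota c)%:M -> x != 0 -> A *m x = iota t *: x -> t <= c.
Proof.
move=> /(loewner_form x) Ac x0 /qform_eigen eA; move: Ac; rewrite eA.
by rewrite -[(iota c)%:M]scalemx1 qformZ ler_pM2r ?qform1_gt0 // ler_embed.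
Qed.

(** If x is an eigenvector of [T *m T^t*] for t > 0, then [T^t* *m x] is one of [T^t* *m T] for the
    same t. Eigenvalues t <= 0 are covered by 0 <= c. *)
Lemma gram_swap n m (T : 'M[C]_(n, m)) c : 0 <= c ->
  T^t* *m T ⪯ (iota c)%:M -> T *m T^t* ⪯ (iota c)%:M.
Proof.
move=> c0 Tc; apply: loewner_scalarP => [|x t x0 ex].
  by have := psd_gram (T^t*); rewrite trmxCK.
have [t0|t0] := leP t 0; first exact: le_trans c0.
apply: (loewner_scalar_eigen (x := T^t* *m x) Tc).
  apply: contraNneq x0 => Tx; move: ex; rewrite -mulmxA Tx mulmx0 => /esym/eqP.
  by rewrite scaler_eq0 => /orP[/eqP/(congr1 re)|//]; rewrite embedK => t1;
    move: t0; rewrite t1 -[X in re X](rmorph0 iota) embedK ltxx.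
by rewrite -mulmxA (mulmxA T) ex scalemxAr.
Qed.

Lemma gram_form n m (T : 'M[C]_(n, m)) c x : T^t* *m T ⪯ (iota c)%:M ->
  qform 1%:M (T *m x) <= iota c * qform 1%:M x.
Proof.
move=> /(loewner_form x).
by rewrite -[(iota c)%:M]scalemx1 qformZ -qform_conj mulmx1.
Qed.

Section CordesGram.
Variables (n : nat) (A B : 'M[C]_n).
Hypotheses (pA : psd A) (pB : psd B).

(** Cordes' inequality says that if the squared operator norm of [T s] is at most 1 at s = 1, it is
    so on [0, 1]. The proof uses midpoint log-convexity of this norm in s and a bound uniform in
    s. *)
Let T s : 'M[C]_n := mxpow B (s / 2) *m mxpow A (s / 2).
Let bnd c s := (T s)^t* *m T s ⪯ (iota c)%:M.

Let pw s (D : 'M[C]_n) := @mxpow_psd _ _ iota _ D s.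

Let T_gram s : 0 <= s ->
  (T s)^t* *m T s = mxpow A (s / 2) *m mxpow B s *m mxpow A (s / 2).
Proof.
move=> s0; rewrite /T trmxC_mul (mxpow_trmxC iota _ pA) (mxpow_trmxC iota _ pB) !mulmxA.
rewrite -(mulmxA (mxpow A (s / 2))) -(mxpowD iota pB) ?divr_ge0 //.
by congr (_ *m mxpow B _ *m _); field.
Qed.

(* XY and YX have the same nonzero eigenvalues, so those of the Gram matrix of
   T ((a + b) / 2) are eigenvalues of (T b)^* T a. *)
Let bnd_mid (a b c c' g : R) : 0 <= a <= b -> 0 <= g -> 0 <= c -> 0 <= c' ->
  c * c' <= g ^+ 2 -> bnd c a -> bnd c' b -> bnd g ((a + b) / 2).
Proof.
move=> /andP[a0 ab] g0 c0 c'0 cc' ba bb.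
have b0 := le_trans a0 ab.
apply: loewner_scalarP => [|x t x0 ex]; first exact: psd_gram.
have [t0|t0] := leP t 0; first exact: le_trans g0.
have D := mxpowD iota.
(* Cycling the factor A^((b - a) / 4) from right to left turns x into an eigenvector y of
   [(T b)^t* *m T a] for the same t; the two norm bounds then give t^2 <= c' c. *)
set y := mxpow A ((b - a) / 4) *m x.
have eH : (T ((a + b) / 2))^t* *m T ((a + b) / 2) =
    mxpow A ((a + b) / 4) *m mxpow B ((a + b) / 2) *m mxpow A (a / 2)
      *m mxpow A ((b - a) / 4).
  rewrite T_gram ?divr_ge0 ?addr_ge0 // -[RHS]mulmxA -D ?divr_ge0 ?subr_ge0 //.
  by congr (mxpow A _ *m _ *m mxpow A _); field.
have ey : (T b)^t* *m T a *m y = iota t *: y.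
  rewrite /y scalemxAr -ex eH !mulmxA; congr (_ *m _ *m _).
  rewrite /T trmxC_mul (mxpow_trmxC iota _ pA) (mxpow_trmxC iota _ pB).
  rewrite -(D _ _ ((b - a) / 4)) ?divr_ge0 ?subr_ge0 ?addr_ge0 //.
  congr (_ *m _); rewrite -mulmxA -(D _ B) ?divr_ge0 //.
  by congr (mxpow A _ *m mxpow B _); field.
have t0' : iota t != 0.
  by apply: contraTneq t0 => /(congr1 re); rewrite embedK -[X in re X](rmorph0 iota)
     embedK => ->; rewrite ltxx.
have y0 : y != 0.
  apply: contraNneq x0 => y0; move: ex; rewrite eH -mulmxA -/y y0 mulmx0.
  by move=> /esym/eqP; rewrite scaler_eq0 (negbTE t0').
have := gram_form (T := (T b)^t*) (T a *m y) (c := c').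
rewrite trmxCK mulmxA ey => /(_ (gram_swap c'0 bb)) h1.
have h2 := gram_form y ba.
have c'0' : 0 <= iota c' by rewrite iota_ge0.
have := le_trans h1 (ler_wpM2l c'0' h2).
have -> : qform 1%:M (iota t *: y) = iota (t ^+ 2) * qform 1%:M y.
  rewrite /qform !mulmx1 -scalemxAr; have -> : (iota t *: y)^t* = iota t *: y^t*.
    by apply/matrixP=> i j; rewrite !mxE rmorphM; congr (_ * _); apply: iota_conj.
  by rewrite -scalemxAl scalerA mxE rmorphXn.
rewrite mulrA -rmorphM ler_pM2r ?qform1_gt0 // ler_embed => h.
by rewrite -(ler_pXn2r (n := 2)) ?nnegrE // ?(ltW t0) //; nra.
Qed.

Let mxpow_bounded (D : 'M[C]_n) : psd D ->
  exists2 c, 1 <= c & forall s, 0 <= s <= 1 -> mxpow D s ⪯ (iota c)%:M.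
Proof.
move=> /(psd_specE iota)[U [d [uU d0 _ eP]]]; have S0 : 0 <= \sum_i d 0 i.
  exact: sumr_ge0.
exists (1 + \sum_i d 0 i); first by rewrite lerDl.
move=> s /andP[s0 s1]; rewrite eP; apply: spec_loewner_scalar => // i.
rewrite mxE; have [di|di] := leP (d 0 i) 1.
  apply: (@le_trans _ _ 1); last by rewrite lerDl.
  have := ge0_ler_powR s0 (x := d 0 i) (y := 1); rewrite powR1 !nnegrE.
  by apply=> //.
apply: le_trans (ler1_powR (ltW di) s1) _; rewrite (bigD1 i) //=.
by rewrite addrCA lerDl addr_ge0 // sumr_ge0.
Qed.

Let bnd_bounded :
  exists2 c, 1 <= c & forall s, 0 <= s <= 1 -> bnd c s.
Proof.
have [a a1 Ha] := mxpow_bounded pA; have [b b1 Hb] := mxpow_bounded pB.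
exists (b * a); first by nra.
move=> s s01; have /andP[s0 s1] := s01; rewrite /bnd T_gram //.
apply: loewner_trans (loewner_conjh (pw _ pA) (Hb s s01)) _.
rewrite mul_mx_scalar -scalemxAl -mxpowD ?divr_ge0 //.
have -> : s / 2 + s / 2 = s by field.
rewrite rmorphM -scale_scalar_mx; apply: loewnerZ; last exact: Ha.
by rewrite iota_ge0 //; lra.
Qed.

(* A bound c valid for all exponents in [0, 1] improves to the square root of c
   by halving towards 0 or 1; no continuity in the exponent is needed. *)
Let bnd1 : bnd 1 1 -> forall s, 0 <= s <= 1 -> bnd 1 s.
Proof.
move=> b1.
have b0 : bnd 1 0.
  rewrite /bnd T_gram // mul0r !mxpow0 // !mulmx1.
  by rewrite rmorph1; apply: loewner_refl.
have bsqrt c : 1 <= c -> (forall s, 0 <= s <= 1 -> bnd (c ^+ 2) s) ->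
    forall s, 0 <= s <= 1 -> bnd c s.
  move=> c1 hb s /andP[s0 s1]; have [s2|s2] := leP s (1 / 2).
    have -> : s = (0 + 2 * s) / 2 by field.
    by apply: (bnd_mid _ _ _ _ _ b0 (hb (2 * s) _));
      rewrite ?mul1r ?lexx ?exprn_ge0 //; try (apply/andP; split); lra.
  have -> : s = ((2 * s - 1) + 1) / 2 by field.
  by apply: (bnd_mid _ _ _ _ _ (hb (2 * s - 1) _) b1);
    rewrite ?mulr1 ?lexx ?exprn_ge0 //; try (apply/andP; split); lra.
have biter k c : 1 <= c -> (forall s, 0 <= s <= 1 -> bnd (c ^+ (2 ^ k)) s) ->
    forall s, 0 <= s <= 1 -> bnd c s.
  elim: k c => [|k IH] c c1 hb; first by move: hb; rewrite expn0 expr1.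
  apply: bsqrt => //; apply: IH; first by rewrite exprn_ege1.
  by rewrite -exprM -expnS.
have [M M1 hM] := bnd_bounded.
(* By Bernoulli's inequality c^(2^k) exceeds the uniform bound M for large k, so k square roots
   bring M below any c > 1. *)
have bgt1 c : 1 < c -> forall s, 0 <= s <= 1 -> bnd c s.
  move=> c1; have bern k : 1 + k%:R * (c - 1) <= c ^+ k.
    elim: k => [|k IH]; first by rewrite mul0r addr0 expr0.
    have k0 : 0 <= k%:R * (c - 1) ^+ 2 by rewrite mulr_ge0 ?sqr_ge0.
    have c0 : 0 <= c by lra.
    by rewrite exprS -natr1; move: (ler_wpM2l c0 IH) k0; rewrite expr2; lra.
  pose k := Num.bound (M / (c - 1)).
  apply: (biter k); first exact: ltW.
  move=> s s01; apply: loewner_trans (hM s s01) _; rewrite /loewner.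
  rewrite -rmorphB -rmorphB /= -[X in psd X]scalemx1; apply: psdZ; last exact: psd1.
  rewrite iota_ge0 // subr_ge0; apply: le_trans (bern _).
  have : M / (c - 1) < k%:R by apply: archi_boundP; rewrite divr_ge0 //; lra.
  rewrite ltr_pdivrMr ?subr_gt0 // => hk.
  have : (k%:R <= (2 ^ k)%:R :> R) by rewrite ler_nat ltnW // ltn_expl.
  nra.
move=> s s01; apply: loewner_scalarP => [|x t x0 ex]; first exact: psd_gram.
(* An eigenvalue t > 1 would exceed the admissible bound (1 + t) / 2. *)
rewrite leNgt; apply/negP => t1.
have := loewner_scalar_eigen (bgt1 ((1 + t) / 2) _ s s01) x0 ex.
by case: (ltP 1 ((1 + t) / 2)) => [_ /(_ isT)|]; lra.
Qed.

Lemma cordes s : 0 <= s <= 1 ->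
  mxpow A (1 / 2) *m B *m mxpow A (1 / 2) ⪯ 1%:M ->
  mxpow A (s / 2) *m mxpow B s *m mxpow A (s / 2) ⪯ 1%:M.
Proof.
move=> s01 h; have /andP[s0 _] := s01.
have := bnd1 _ s01; rewrite /bnd !T_gram // rmorph1; apply.
by rewrite mxpow1.
Qed.

End CordesGram.
End Cordes.

(** * The norm inequality *)

Section NormInequality.
Variables (R : realType) (C : numClosedFieldType) (iota : real_embedding R C).
Implicit Types (n : nat) (a b s t : R).
Local Notation mxpow := (mxpow iota).

(* Negative exponents are allowed: since 0 `^ (- s) = 0 for s != 0, a negative
   power of a singular matrix is a pseudo-inverse. *)
Lemma mxpowD_neq0 n (A : 'M[C]_n) s t : psd A -> s + t != 0 ->
  mxpow A (s + t) = mxpow A s *m mxpow A t.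
Proof.
move=> /(psd_specE iota)[U [d [uU _ _ eA]]] st0.
rewrite !eA specM //; congr spectral_mx.
by apply/rowP=> i; rewrite !mxE powRD // (negbTE st0).
Qed.

Lemma psd_sandwich n (A B : 'M[C]_n) s : psd A -> psd B ->
  psd (mxpow A s *m B *m mxpow A s).
Proof.
by move=> pA /(psd_conj (mxpow A s)); rewrite mxpow_trmxC.
Qed.

(** Cordes' inequality for the pair A^(2a), B^b. *)
Lemma cordes_pow n (A B : 'M[C]_n) a b s : psd A -> psd B -> 0 <= s <= 1 ->
  mxpow A a *m mxpow B b *m mxpow A a ⪯ 1%:M ->
  mxpow A (s * a) *m mxpow B (s * b) *m mxpow A (s * a) ⪯ 1%:M.
Proof.
move=> pA pB s01 h.
have := cordes (iota := iota) (mxpow_psd iota (2 * a) pA) (mxpow_psd iota b pB) s01.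
rewrite !mxpow_mxpow //.
have -> : 2 * a * (1 / 2) = a by field.
have -> : 2 * a * (s / 2) = s * a by field.
by rewrite (mulrC b); apply.
Qed.

(** The two Gram matrices of B^b A^a, compared by [gram_swap] with c = 1. *)
Lemma loewner1_swap n (A B : 'M[C]_n) a b : psd A -> psd B -> 0 <= a -> 0 <= b ->
  mxpow A a *m mxpow B (2 * b) *m mxpow A a ⪯ 1%:M ->
  mxpow B b *m mxpow A (2 * a) *m mxpow B b ⪯ 1%:M.
Proof.
move=> pA pB a0 b0; rewrite -(rmorph1 iota) => h.
have := @gram_swap _ _ iota n n (mxpow B b *m mxpow A a) 1 ler01.
rewrite trmxC_mul (mxpow_trmxC iota _ pA) (mxpow_trmxC iota _ pB) !mulmxA.
rewrite -(mulmxA (mxpow A a)) -(mxpowD iota pB b0 b0).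
rewrite -(mulmxA (mxpow B b)) -(mxpowD iota pA a0 a0).
have -> : b + b = 2 * b by ring.
have -> : a + a = 2 * a by ring.
by apply.
Qed.

Section Key.
Variables (n : nat) (A B : 'M[C]_n) (q r : R).
Hypotheses (pA : psd A) (pB : psd B) (q1 : 1 <= q) (r0 : 0 <= r).
Hypothesis AB1 :
  mxpow A ((r + q) / 2) *m mxpow B q *m mxpow A ((r + q) / 2) ⪯ 1%:M.

Let X := mxpow A (1 / 2) *m B *m mxpow A (1 / 2).

Let q_gt0 : 0 < q. Proof. exact: lt_le_trans ltr01 q1. Qed.
Let rq_gt0 : 0 < r + q. Proof. exact: ltr_wpDl. Qed.
Let pX : psd X. Proof. exact: psd_sandwich. Qed.
Let D (E : 'M[C]_n) s t := @mxpowD _ _ iota n E s t.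

(** Cordes' inequality with s = b / q; the equation keeps a : b equal to the ratio (r + q) / 2 : q
    of the hypothesis. *)
Let AB_pow a b : 0 <= b <= q -> 2 * a * q = b * (r + q) ->
  mxpow A a *m mxpow B b *m mxpow A a ⪯ 1%:M.
Proof.
move=> /andP[b0 bq] ab; have q0 := lt0r_neq0 q_gt0.
have s01 : 0 <= b / q <= 1.
  by rewrite divr_ge0 ?ler_pdivrMr ?mul1r // ltW.
have := cordes_pow pA pB s01 AB1.
have -> : b / q * q = b by field.
suff -> : b / q * ((r + q) / 2) = a by [].
have -> : a = b * (r + q) / (2 * q) by rewrite -ab; field.
by field.
Qed.

Lemma norm_inequality_le2 : q <= 2 ->
  mxpow A (r / 2) *m mxpow X q *m mxpow A (r / 2) ⪯ 1%:M.
Proof.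
have [[[q1' r0'] q_gt0'] rq_gt0'] := (q1, r0, q_gt0, rq_gt0).
move=> q2; set T := mxpow A (1 / 2) *m mxpow B (1 / 2).
set Y := mxpow B (1 / 2) *m A *m mxpow B (1 / 2).
have h0 : 0 <= 1 / 2 :> R by lra.
have eT : T^t* = mxpow B (1 / 2) *m mxpow A (1 / 2).
  by rewrite trmxC_mul (mxpow_trmxC iota _ pA) (mxpow_trmxC iota _ pB).
have half (E : 'M[C]_n) : psd E -> mxpow E (1 / 2) *m mxpow E (1 / 2) = E.
  move=> pE; rewrite -D //; have -> : 1 / 2 + 1 / 2 = 1 :> R by field.
  exact: mxpow1.
have eX : X = T *m T^t*.
  by rewrite eT /T mulmxA -(mulmxA (mxpow A _)) half.
have eY : Y = T^t* *m T.
  by rewrite eT /T mulmxA -(mulmxA (mxpow B _)) half.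
have pY : psd Y by rewrite eY; apply: psd_gram.
(* X^(q-1) T = T Y^(q-1), because X T = T Y. *)
have eXq : mxpow X q = T *m mxpow Y (q - 1) *m T^t*.
  have -> : q = q - 1 + 1 by ring.
  rewrite D ?mxpow1 ?subr_ge0 // addrK {2}eX mulmxA; congr (_ *m _).
  by apply: mxpow_intertwine => //; rewrite eX eY mulmxA.
set rho := r / (r + q).
have rqn0 := lt0r_neq0 rq_gt0.
have w0 : 0 < q / (r + q) by rewrite divr_gt0.
have w1 : q / (r + q) <= 1 by rewrite ler_pdivrMr // mul1r; lra.
have ew : 1 - rho = q / (r + q) by rewrite /rho; field.
have rho0 : 0 <= rho by rewrite divr_ge0 // ltW.
have pBrho : psd (mxpow B (- rho)) by exact: mxpow_psd.
(* For invertible B this is Y <= B^rho. The negative powers leave B^((1 - rho) / 2) A B^((1 - rho) /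
   2), and the choice 1 - rho = q / (r + q) makes this, after a swap, [AB_pow] with a = 1 / 2. *)
have hY : mxpow B (- rho / 2) *m Y *m mxpow B (- rho / 2) ⪯ 1%:M.
  have nz : - rho / 2 + 1 / 2 != 0.
    by apply: lt0r_neq0; lra.
  have nz' : 1 / 2 + - rho / 2 != 0 by rewrite addrC.
  rewrite /Y !mulmxA -(mxpowD_neq0 pB nz) -!mulmxA -(mxpowD_neq0 pB nz') mulmxA.
  rewrite [1 / 2 + _]addrC.
  have -> : - rho / 2 + 1 / 2 = q / (r + q) / 2 by rewrite -ew; field.
  have := @loewner1_swap n A B (1 / 2) (q / (r + q) / 2) pA pB h0.
  have -> : 2 * (1 / 2) = 1 :> R by field.
  rewrite mxpow1 //; apply; first by rewrite divr_ge0 // ltW.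
  apply: AB_pow; last by field.
  have -> : 2 * (q / (r + q) / 2) = q / (r + q) by field.
  by rewrite (ltW w0) /= (le_trans w1).
(* Here 1 <= q <= 2 matters: Cordes' inequality is applied to B^(-rho) and Y with exponent q - 1. *)
have s01 : 0 <= q - 1 <= 1 by apply/andP; split; lra.
have := cordes (iota := iota) pBrho pY s01.
rewrite !mxpow_mxpow //.
have -> : - rho * (1 / 2) = - rho / 2 by field.
move=> /(_ hY); set s := - rho * ((q - 1) / 2) => hYs.
have hBY : mxpow B (1 / 2) *m mxpow Y (q - 1) *m mxpow B (1 / 2) ⪯
    mxpow B (1 + rho * (q - 1)).
  have rq : 0 <= rho * (q - 1) by rewrite mulr_ge0 // subr_ge0.
  (* Since s + v = 1 / 2, conjugation by B^v turns the outer factors B^s into B^(1/2) and the bound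
     1 into B^(2v). *)
  set v := (1 + rho * (q - 1)) / 2.
  have v0 : 0 <= v by rewrite /v; lra.
  have sv : s + v = 1 / 2 by rewrite /s /v; field.
  have nz : s + v != 0 by rewrite sv; apply: lt0r_neq0; lra.
  have nz' : v + s != 0 by rewrite addrC.
  have := loewner_conjh (mxpow_psd iota v pB) hYs.
  rewrite mulmx1 -D //; have -> : v + v = 1 + rho * (q - 1) by rewrite /v; field.
  rewrite !mulmxA -(mxpowD_neq0 pB nz') -!mulmxA -(mxpowD_neq0 pB nz).
  by rewrite [v + s]addrC sv.
have hh : 0 <= r / 2 by rewrite divr_ge0.
have -> : mxpow A (r / 2) *m mxpow X q *m mxpow A (r / 2) =
    mxpow A ((r + 1) / 2) *m
      (mxpow B (1 / 2) *m mxpow Y (q - 1) *m mxpow B (1 / 2)) *m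
    mxpow A ((r + 1) / 2).
  have e : mxpow A ((r + 1) / 2) = mxpow A (r / 2) *m mxpow A (1 / 2).
    by rewrite -D //; congr mxpow; field.
  have e' : mxpow A ((r + 1) / 2) = mxpow A (1 / 2) *m mxpow A (r / 2).
    by rewrite -D //; congr mxpow; field.
  by rewrite {1}e e' eXq eT /T !mulmxA.
apply: loewner_trans (loewner_conjh (mxpow_psd iota _ pA) hBY) _.
(* The exponents match because (1 + rho (q - 1)) (r + q) = (r + 1) q; rho <= 1 keeps the exponent of
   B at most q. *)
apply: AB_pow; last by rewrite /rho; field.
apply/andP; split; first by rewrite addr_ge0 // mulr_ge0 // subr_ge0.
have : rho * (q - 1) <= q - 1.
  by rewrite ler_piMl ?subr_ge0 // /rho ler_pdivrMr // mul1r; lra.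
lra.
Qed.

Lemma norm_inequality_ge2 : 2 <= q -> r * (q - 2) <= q ->
  mxpow A (r / 2) *m mxpow X q *m mxpow A (r / 2) ⪯ 1%:M.
Proof.
have [[[q1' r0'] q_gt0'] rq_gt0'] := (q1, r0, q_gt0, rq_gt0).
move=> q2 rq; have q0 := lt0r_neq0 q_gt0; have rqn0 := lt0r_neq0 rq_gt0.
pose P s := mxpow A (r * s / (2 * q)) *m mxpow X s *m
  mxpow A (r * s / (2 * q)) ⪯ 1%:M.
have down s t : 0 <= t -> t <= s -> P s -> P t.
  move=> t0 ts; have [s0|s0] := leP s 0.
    by have -> : t = s by lra.
  move=> Ps; have st : 0 <= t / s <= 1.
    by rewrite divr_ge0 ?ler_pdivrMr ?mul1r //= ltW.
  have := cordes_pow pA pX st Ps.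
  have -> : t / s * s = t by field; rewrite lt0r_neq0.
  suff -> : t / s * (r * s / (2 * q)) = r * t / (2 * q) by [].
  by field; rewrite q0 lt0r_neq0.
have h0 : 0 <= 1 / 2 :> R by lra.
(* After absorbing the factors A^(1/2) of X, this is [AB_pow] with b = 1. *)
have P1 : P 1.
  rewrite /P mxpow1 // mulr1; set e := r / (2 * q).
  have e0 : 0 <= e by rewrite divr_ge0 // mulr_ge0 // ltW.
  have -> : mxpow A e *m X *m mxpow A e =
      mxpow A (e + 1 / 2) *m mxpow B 1 *m mxpow A (e + 1 / 2).
    rewrite {1}D // [e + _]addrC D // mxpow1 // /X !mulmxA.
    by [].
  apply: AB_pow; first by rewrite ler01 q1.
  by rewrite /e; field.
have step s : 0 <= s <= q - 2 -> P s -> P (s + 2).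
  move=> /andP[s0 sq] Ps.
  set f := r * s / q.
  have f0 : 0 <= f by rewrite divr_ge0 ?mulr_ge0 // ltW.
  have f1 : f <= 1.
    rewrite ler_pdivrMr // mul1r; apply: le_trans rq.
    by rewrite ler_wpM2l.
  have hX : mxpow A (1 / 2) *m mxpow X s *m mxpow A (1 / 2) ⪯ mxpow A (1 - f).
    have g0 : 0 <= (1 - f) / 2 by lra.
    have := loewner_conjh (mxpow_psd iota ((1 - f) / 2) pA) Ps.
    have e0 : 0 <= f / 2 by lra.
    have -> : r * s / (2 * q) = f / 2 by rewrite /f; field.
    rewrite mulmx1 !mulmxA -D // -!mulmxA -D // -D // !mulmxA [f / 2 + _]addrC.
    have -> : (1 - f) / 2 + f / 2 = 1 / 2 by field.
    by have -> : (1 - f) / 2 + (1 - f) / 2 = 1 - f by field.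
  (* u solves (1 - f) q = u (r + q), so [AB_pow] bounds A^((1 - f) / 2) B^u A^((1 - f) / 2); u <= 1
     leaves a nonnegative exponent 1 - u / 2 for the conjugation by a power of B. *)
  set u := q * (1 - f) / (r + q).
  have u0 : 0 <= u by rewrite divr_ge0 ?mulr_ge0 ?subr_ge0 // ltW.
  have u1 : u <= 1.
    rewrite ler_pdivrMr // mul1r; apply: (@le_trans _ _ q); last by lra.
    by rewrite ler_piMr ?(ltW q_gt0) //; lra.
  have hB : B *m mxpow A (1 - f) *m B ⪯ mxpow B (2 - u).
    have v0 : 0 <= 1 - u / 2 by lra.
    have hu : mxpow B (u / 2) *m mxpow A (1 - f) *m mxpow B (u / 2) ⪯ 1%:M.
      have := @loewner1_swap n A B ((1 - f) / 2) (u / 2) pA pB.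
      have -> : 2 * ((1 - f) / 2) = 1 - f by field.
      have -> : 2 * (u / 2) = u by field.
      apply; [lra|lra|apply: AB_pow]; last by rewrite /u; field.
      by rewrite u0; lra.
    have := loewner_conjh (mxpow_psd iota (1 - u / 2) pB) hu.
    have u20 : 0 <= u / 2 by lra.
    rewrite mulmx1 !mulmxA -D // -!mulmxA -D // -D // !mulmxA [u / 2 + _]addrC.
    have -> : 1 - u / 2 + u / 2 = 1 by field.
    have -> : 1 - u / 2 + (1 - u / 2) = 2 - u by field.
    by rewrite mxpow1.
  rewrite /P; set e := r * (s + 2) / (2 * q).
  have e0 : 0 <= e by rewrite divr_ge0 ?mulr_ge0 ?addr_ge0 // ltW.
  have -> : mxpow A e *m mxpow X (s + 2) *m mxpow A e =
      mxpow A (e + 1 / 2) *m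
        (B *m (mxpow A (1 / 2) *m mxpow X s *m mxpow A (1 / 2)) *m B) *m
      mxpow A (e + 1 / 2).
    have -> : s + 2 = 1 + s + 1 by ring.
    rewrite (D pX) ?addr_ge0 // (D pX) // (mxpow1 iota pX).
    by rewrite {2}[e + _]addrC !(D pA) // {1 3}/X !mulmxA.
  apply: loewner_trans (loewner_conjh (mxpow_psd iota _ pA) _) _.
    apply: loewner_trans (loewner_conjh pB hX) hB.
  (* Both sides of the exponent equation equal r (s + 2) + q. *)
  apply: AB_pow; last by rewrite /e /u /f; field; rewrite rqn0 q0.
  by apply/andP; split; lra.
(* Descent by 2 from a real s, with k as counter. Exponents at most 1 follow from [P 1], and those
   in (1, 2] from [P 2], the step applied to [P 0]. *)
have all_P k : forall s, 0 <= s <= q -> s <= k%:R -> P s.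
  elim: k => [|k IH] s /andP[s0 sq] sk; first by apply: down P1; lra.
  have [s1|s1] := leP s 1; first exact: down P1.
  have [s2|s2] := leP s 2.
    apply: (down (0 + 2)); [lra|lra|apply: step]; first by rewrite lexx; lra.
    by apply: down P1; lra.
  have -> : s = s - 2 + 2 by ring.
  apply: step; first by apply/andP; split; lra.
  apply: IH; first by apply/andP; split; lra.
  by move: sk; rewrite -natr1; lra.
have := all_P (Num.bound q) q; rewrite /P.
have -> : r * q / (2 * q) = r / 2 by field.
apply; first by rewrite lexx ltW.
by apply/ltW/archi_boundP/ltW.
Qed.

End Key.
End NormInequality.

(** * Compound matrices *)

Section CauchyBinet.
Variable K : comNzRingType.
Implicit Types n m k l : nat.

Definition ksub n k := {S : {set 'I_n} | #|S| == k}.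

Definition ksub_enum n k (S : ksub n k) (i : 'I_k) : 'I_n :=
  enum_val (cast_ord (esym (eqP (valP S))) i).

Lemma ksub_enum_in n k (S : ksub n k) i : ksub_enum S i \in val S.
Proof. exact: enum_valP. Qed.

Lemma ksub_enum_inj n k (S : ksub n k) : injective (ksub_enum S).
Proof. by move=> i j /enum_val_inj/cast_ord_inj. Qed.

Lemma ksub_enum_surj n k (S : ksub n k) x :
  x \in val S -> exists i, ksub_enum S i = x.
Proof.
move=> xS; exists (cast_ord (eqP (valP S)) (enum_rank_in xS x)).
by rewrite /ksub_enum cast_ordK enum_rankK_in.
Qed.

Lemma ksub_imset n k (S : ksub n k) : [set ksub_enum S i | i in 'I_k] = val S.
Proof.
apply/setP=> x; apply/imsetP/idP => [[i _ ->]|/ksub_enum_surj[i <-]].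
  exact: ksub_enum_in.
by exists i.
Qed.

(** Each row of [M *m N] is a combination of rows of N; f records which row of N is chosen when the
    determinant is expanded multilinearly. *)
Lemma det_mulmx_ffun n k (M : 'M[K]_(k, n)) (N : 'M[K]_(n, k)) :
  \det (M *m N) =
  \sum_(f : {ffun 'I_k -> 'I_n}) (\prod_i M i (f i)) * \det (rowsub f N).
Proof.
rewrite /determinant; under eq_bigr => s _.
  under eq_bigr => i _ do rewrite mxE.
  rewrite bigA_distr_bigA /= mulr_sumr.
  over.
rewrite exchange_big /=; apply: eq_bigr => f _; rewrite mulr_sumr.
apply: eq_bigr => s _; rewrite big_split /= mulrCA; congr (_ * (_ * _)).
by apply: eq_bigr => i _; rewrite mxE.
Qed.

Lemma det_rowsub_perm n k (N : 'M[K]_(n, k)) (f : 'I_k -> 'I_n) (s : 'S_k) :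
  \det (rowsub (f \o s) N) = (-1) ^+ s * \det (rowsub f N).
Proof.
rewrite -det_perm -det_mulmx -row_permE; congr (\det _).
by apply/matrixP=> i j; rewrite !mxE.
Qed.

(** A choice f that is not injective repeats a row and contributes 0. The injective ones are grouped
    by image S; within a group they differ by permutations, whose signs assemble the minor of M. *)
Theorem cauchy_binet n k (M : 'M[K]_(k, n)) (N : 'M[K]_(n, k)) :
  \det (M *m N) =
  \sum_(S : ksub n k)
    \det (colsub (ksub_enum S) M) * \det (rowsub (ksub_enum S) N).
Proof.
rewrite det_mulmx_ffun (bigID (fun f : {ffun 'I_k -> 'I_n} => injectiveb f)) /=.
rewrite [X in _ + X]big1 ?addr0; last first.
  move=> f /injectivePn[i [j ij fij]].
  rewrite [\det _](determinant_alternate ij) ?mulr0 // => l.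
  by rewrite !mxE fij.
pose G (f : {ffun 'I_k -> 'I_n}) := (\prod_i M i (f i)) * \det (rowsub f N).
pose im (f : {ffun 'I_k -> 'I_n}) := [set f i | i in 'I_k].
have eS (S : ksub n k) :
    \det (colsub (ksub_enum S) M) * \det (rowsub (ksub_enum S) N) =
    \sum_(f : {ffun 'I_k -> 'I_n} | injectiveb f && (im f == val S)) G f.
  pose h (s : 'S_k) : {ffun 'I_k -> 'I_n} := [ffun i => ksub_enum S (s i)].
  have h_inj : injective h.
    move=> s t /ffunP st; apply/permP => i.
    by have := st i; rewrite !ffunE => /ksub_enum_inj.
  have him (f : {ffun 'I_k -> 'I_n}) :
      injectiveb f && (im f == val S) = (f \in [set h s | s in 'S_k]).
    apply/andP/imsetP => [[/injectiveP fi /eqP fS]|[s _ ->]].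
      have /fin_all_exists[t tP] i : exists j, ksub_enum S j = f i.
        by apply: ksub_enum_surj; rewrite -fS imset_f.
      have t_inj : injective t by move=> i j tij; apply: fi; rewrite -!tP tij.
      by exists (perm t_inj) => //; apply/ffunP=> i; rewrite ffunE permE tP.
    have hi : injective (h s).
      by move=> i j; rewrite !ffunE => /ksub_enum_inj/perm_inj.
    split; first exact/injectiveP.
    rewrite eqEcard card_imset // card_ord (eqP (valP S)) leqnn andbT.
    by apply/subsetP => _ /imsetP[i _ ->]; rewrite ffunE ksub_enum_in.
  rewrite (eq_bigl _ _ him) big_imset /=; last by move=> s t _ _; apply: h_inj.
  rewrite /determinant mulr_suml; apply: eq_big => [s|s _]; first by rewrite inE.
  rewrite /G (_ : rowsub (h s) N = rowsub (ksub_enum S \o s) N); last first.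
    by apply/matrixP=> i j; rewrite !mxE ffunE.
  rewrite det_rowsub_perm mulrA; congr (_ * _); rewrite mulrC; congr (_ * _).
  by apply: eq_bigr => i _; rewrite mxE ffunE.
under [RHS]eq_bigr => S _ do rewrite eS.
rewrite (exchange_big_dep (fun f : {ffun 'I_k -> 'I_n} => injectiveb f)) /=;
  last by move=> S f _ /andP[].
apply: eq_bigr => f fi; have imk : #|im f| == k.
  by rewrite card_imset ?card_ord //; apply/injectiveP.
rewrite (big_pred1 (exist _ (im f) imk)) // => S.
by rewrite fi /= eq_sym -val_eqE.
Qed.

(** The matrix of the k-th exterior power of A; Cauchy-Binet is its multiplicativity. *)
Definition compound k n m (A : 'M[K]_(n, m)) : 'M[K]_(#|{: ksub n k}|, #|{: ksub m k}|) :=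
  \matrix_(i, j) \det (mxsub (ksub_enum (enum_val i)) (ksub_enum (enum_val j)) A).

Lemma compoundM k n m l (A : 'M[K]_(n, m)) (B : 'M[K]_(m, l)) :
  compound k (A *m B) = compound k A *m compound k B.
Proof.
apply/matrixP=> i j; rewrite !mxE mxsub_mul cauchy_binet.
rewrite (reindex _ (onW_bij _ (@enum_val_bij (ksub m k)))) /=.
apply: eq_bigr => S _; rewrite !mxE; congr (_ * _); congr determinant;
  by apply/matrixP=> a b; rewrite !mxE.
Qed.

Lemma compound_diag k n (d : 'rV[K]_n) :
  compound k (diag_mx d) =
  diag_mx (\row_j \prod_(x in val (enum_val j : ksub n k)) d 0 x).
Proof.
apply/matrixP=> i j; rewrite !mxE; have [<-|ij] := eqVneq i j.
  rewrite mulr1n; set S := enum_val i.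
  have -> : mxsub (ksub_enum S) (ksub_enum S) (diag_mx d) =
      diag_mx (\row_a d 0 (ksub_enum S a)).
    by apply/matrixP=> a b; rewrite !mxE (inj_eq (@ksub_enum_inj _ _ S)).
  rewrite det_diag -ksub_imset big_imset /=; last first.
    by move=> a b _ _; apply: ksub_enum_inj.
  by apply: eq_bigr => a _; rewrite mxE.
rewrite mulr0n; set S := enum_val i; set T := enum_val j.
(* Distinct sets of equal size: some x in S is missing from T, and its row in the minor is zero. *)
have [x xS xT] : exists2 x, x \in val S & x \notin val T.
  apply/subsetPn; apply: contraNN ij => ST; apply/eqP/enum_val_inj/val_inj.
  by apply/eqP; rewrite eqEcard ST (eqP (valP S)) (eqP (valP T)) leqnn.
have [a ax] := ksub_enum_surj xS.
rewrite (expand_det_row _ a) big1 // => b _; rewrite !mxE ax.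
rewrite (_ : (x == _) = false) ?mulr0n ?mul0r //.
by apply: contraNF xT => /eqP ->; apply: ksub_enum_in.
Qed.

Lemma compound1 k n : compound k (1%:M : 'M[K]_n) = 1%:M.
Proof.
rewrite -diag_const_mx compound_diag -diag_const_mx; congr diag_mx.
by apply/rowP=> j; rewrite !mxE big1 // => x _; rewrite mxE.
Qed.

End CauchyBinet.

(** * Log-majorization for p = 1 *)

Section CharPoly.
Variable F : fieldType.

(** The block matrix with rows (X, A) and (B, 1) is made triangular by elimination from the right
    and from the left; the second way costs a factor X^n, which is cancelled. *)
Lemma char_poly_mulC n (A B : 'M[F]_n) : char_poly (A *m B) = char_poly (B *m A).
Proof.
pose a : 'M_n := map_mx polyC A; pose b : 'M_n := map_mx polyC B.
pose M : 'M[{poly F}]_(n + n) := block_mx 'X%:M a b 1%:M.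
have e1 : \det M = char_poly (A *m B).
  have := det_mulmx M (block_mx 1%:M 0 (- b) 1%:M).
  rewrite det_lblock !det1 !mulr1 => <-.
  rewrite mulmx_block !mulmx1 !mulmx0 !mul1mx !add0r subrr det_ublock det1 mulr1.
  by rewrite /char_poly /char_poly_mx map_mxM mulmxN.
have e2 : 'X ^+ n * \det M = 'X ^+ n * char_poly (B *m A).
  have := det_mulmx (block_mx 1%:M 0 (- b) 'X%:M) M.
  rewrite det_lblock det1 mul1r det_scalar => <-.
  rewrite mulmx_block !mul1mx !mul0mx !addr0 mulmx1.
  rewrite mulNmx mul_mx_scalar mul_scalar_mx addNr det_ublock det_scalar.
  by rewrite /char_poly /char_poly_mx map_mxM mulNmx addrC.
rewrite -e1; apply: (mulfI _ e2); exact/monic_neq0/monicXn.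
Qed.

End CharPoly.

(** * Compounds of positive semidefinite matrices and products of top eigenvalues *)

Section Compounds.
Variables (R : realType) (C : numClosedFieldType) (iota : real_embedding R C).
Implicit Types (n k : nat) (s t c : R).
Local Notation mxpow := (mxpow iota).
Local Notation spec := (spectral_mx iota).

Lemma compound_trmxC k n m (A : 'M[C]_(n, m)) :
  compound k (A^t*) = (compound k A)^t*.
Proof.
apply/matrixP=> i j; rewrite !mxE -det_map_mx -det_tr; congr (\det _).
by apply/matrixP=> a b; rewrite !mxE.
Qed.

Lemma compound_unitary k n (U : 'M[C]_n) :
  U \is unitarymx -> compound k U \is unitarymx.
Proof.
move=> uU; apply/unitarymxP.
by rewrite -compound_trmxC -compoundM unitarymx_mul // compound1.
Qed.

Definition ksub_prod k n (d : 'rV[R]_n) : 'rV[R]_#|{: ksub n k}| :=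
  \row_j \prod_(x in val (enum_val j : ksub n k)) d 0 x.

Lemma compound_spec k n (U : 'M[C]_n) d :
  compound k (spec U d) = spec (compound k U) (ksub_prod k d).
Proof.
rewrite /spectral_mx !compoundM compound_trmxC compound_diag.
congr (_ *m diag_mx _ *m _); apply/rowP=> j; rewrite !mxE rmorph_prod.
by apply: eq_bigr => x _; rewrite mxE.
Qed.

Lemma ksub_prod_ge0 k n (d : 'rV[R]_n) :
  (forall i, 0 <= d 0 i) -> forall j, 0 <= ksub_prod k d 0 j.
Proof. by move=> d0 j; rewrite mxE prodr_ge0. Qed.

Lemma powR_prod (I : finType) (P : pred I) (f : I -> R) s :
  (forall i, 0 <= f i) ->
  (\prod_(i | P i) f i) `^ s = \prod_(i | P i) (f i `^ s).
Proof.
move=> f0; suff [] : 0 <= \prod_(i | P i) f i /\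
  (\prod_(i | P i) f i) `^ s = \prod_(i | P i) (f i `^ s) by [].
elim/big_rec2: _ => [|i y x _ [x0 <-]]; first by rewrite powR1.
by rewrite mulr_ge0 // powRM.
Qed.

Lemma compound_psd k n (A : 'M[C]_n) : psd A -> psd (compound k A).
Proof.
move=> /(psd_specE iota)[U [d [uU d0 -> _]]]; rewrite compound_spec.
by apply: spec_psd; apply: ksub_prod_ge0.
Qed.

Lemma compound_mxpow k n (A : 'M[C]_n) s : psd A ->
  compound k (mxpow A s) = mxpow (compound k A) s.
Proof.
move=> /(psd_specE iota)[U [d [uU d0 -> ->]]]; rewrite !compound_spec.
rewrite mxpow_spec; last 2 first.
- exact: compound_unitary.
- exact: ksub_prod_ge0.
by congr spectral_mx; apply/rowP=> j; rewrite !mxE powR_prod //;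
  apply: eq_bigr => x _; rewrite mxE.
Qed.

Lemma specE n (U : 'M[C]_n) d i j :
  spec U d i j = \sum_l (U l i)^* * iota (d 0 l) * U l j.
Proof.
rewrite /spectral_mx mul_mx_diag mxE; apply: eq_bigr => l _.
by rewrite !mxE.
Qed.

Lemma widen_ord_inj m n (le_mn : (m <= n)%N) : injective (widen_ord le_mn).
Proof. by move=> x y /(congr1 val) /= /val_inj. Qed.

Definition decreasing n (d : 'rV[R]_n) : Prop :=
  forall i j : 'I_n, (i <= j)%N -> d 0 j <= d 0 i.

Lemma psd_decreasing n (A : 'M[C]_n) : psd A ->
  exists (U : 'M[C]_n) (d : 'rV[R]_n),
  [/\ U \is unitarymx, forall i, 0 <= d 0 i, decreasing d & A = spec U d].
Proof.
move=> /(psd_specE iota)[U [d [uU d0 -> _]]].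
pose t : n.-tuple R := [tuple d 0 i | i < n].
have : perm_eq (sort >=%R t) t by rewrite perm_sort.
case/tuple_permP => s es.
exists (row_perm s U), (col_perm s d); split=> [|i|i j ij|].
- apply/unitarymxP; rewrite row_permE trmxC_mul mulmxA -(mulmxA _ U).
  rewrite unitarymx_mul // mulmx1 -map_trmx map_perm_mx tr_perm_mx -perm_mxM.
  by rewrite gsimp perm_mx1.
- by rewrite mxE.
- have st : sorted >=%R (sort >=%R t) by apply: sort_sorted => x y; exact: ge_total.
  have e l : nth 0 (sort >=%R t) (nat_of_ord l) = d 0 (s l).
    by rewrite es nth_mktuple tnth_mktuple.
  rewrite !mxE -!e; apply: (sorted_leq_nth _ _ _ st) => //.
  + by move=> x y z xy yz; apply: le_trans yz xy.
  + by move=> x; apply: lexx.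
  + by rewrite inE size_sort size_tuple.
  + by rewrite inE size_sort size_tuple.
- apply/matrixP=> i j; rewrite !specE (reindex_inj (@perm_inj _ s)).
  by apply: eq_bigr => l _; rewrite !mxE.
Qed.

(** Let S0 be the initial segment of the size of S. Off the common indices, S and S0 keep equally
    many; if m is the least index left in S, the factors left in S are at most d m and those left in
    S0 at least d m. *)
Lemma top_prod_max n (d : 'rV[R]_n) (S : {set 'I_n}) :
  (forall i, 0 <= d 0 i) -> decreasing d ->
  \prod_(x in S) d 0 x <= \prod_(x : 'I_n | (x < #|S|)%N) d 0 x.
Proof.
move=> d0 dd; pose S0 := [set x : 'I_n | (x < #|S|)%N].
have eS0 : \prod_(x : 'I_n | (x < #|S|)%N) d 0 x = \prod_(x in S0) d 0 x.
  by apply: eq_bigl => x; rewrite inE.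
have cS0 : #|S0| = #|S|.
  have Sn : (#|S| <= n)%N by rewrite -[X in (_ <= X)%N]card_ord max_card.
  rewrite -[RHS]card_ord -(card_imset _ (@widen_ord_inj _ _ Sn)).
  apply: eq_card => x; rewrite inE; apply/idP/imsetP => [xS|[y _ ->]].
    by exists (Ordinal xS) => //; apply: val_inj.
  exact: (ltn_ord y).
rewrite eS0 (big_setID S0) [leRHS](big_setID S) /= setIC.
apply: ler_wpM2l; first by rewrite prodr_ge0.
have cD : #|S :\: S0| = #|S0 :\: S|.
  by rewrite !cardsD cS0 setIC.
have [e|[y yS]] := set_0Vmem (S :\: S0).
  by rewrite e big_set0 (_ : S0 :\: S = set0) ?big_set0 //;
     apply/eqP; rewrite -cards_eq0 -cD e cards0.
have [m mS mP] : exists2 m, m \in S :\: S0 &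
    forall x, x \in S :\: S0 -> d 0 x <= d 0 m.
  case: (arg_minnP (fun x : 'I_n => x : nat) yS) => m mS mP.
  by exists m => // x /mP; apply: dd.
apply: (@le_trans _ _ (d 0 m ^+ #|S :\: S0|)).
  by rewrite -prodr_const; apply: ler_prod => x xS; rewrite d0 mP.
rewrite cD -prodr_const; apply: ler_prod => x; rewrite d0 /= => xS; apply: dd.
move: mS xS; rewrite !inE -leqNgt => /andP[hm _] /andP[_ hx].
exact: ltnW (leq_trans hx hm).
Qed.

Lemma spec_loewner_scalar_diag n (U : 'M[C]_n) (d : 'rV[R]_n) c :
  U \is unitarymx -> spec U d ⪯ (iota c)%:M -> forall i, d 0 i <= c.
Proof.
move=> uU h i; have [x x0 ex] := spec_eigenvector iota d i uU.
exact: loewner_scalar_eigen h x0 ex.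
Qed.

(** The product of the first k entries of d is the top eigenvalue of one compound, that of e is an
    eigenvalue of the other, and scalar upper bounds compare the two. *)
Lemma compound_top_prod n (U V : 'M[C]_n) (d e : 'rV[R]_n) k :
  U \is unitarymx -> V \is unitarymx ->
  (forall i, 0 <= d 0 i) -> decreasing d -> (k <= n)%N ->
  (forall c, 0 < c -> compound k (spec U d) ⪯ (iota c)%:M ->
                      compound k (spec V e) ⪯ (iota c)%:M) ->
  \prod_(x : 'I_n | (x < k)%N) e 0 x <= \prod_(x : 'I_n | (x < k)%N) d 0 x.
Proof.
move=> uU uV d0 dd kn h; rewrite leNgt; apply/negP => lt_de.
set D := \prod_(x : 'I_n | _) d 0 x in lt_de.
set E := \prod_(x : 'I_n | _) e 0 x in lt_de.
have D0 : 0 <= D by rewrite prodr_ge0.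
(* D itself may be 0, while c must be positive; the midpoint is positive and still separates D from
   E. *)
have {h}h := h ((D + E) / 2) _ _; have {}h : compound k (spec V e) ⪯
    (iota ((D + E) / 2))%:M.
  apply: h; first by lra.
  rewrite compound_spec; apply: spec_loewner_scalar => [|j].
    exact: compound_unitary.
  rewrite mxE; set S := enum_val j.
  have := top_prod_max (val S) d0 dd; rewrite (eqP (valP S)) -/D; lra.
move: h; rewrite compound_spec => /spec_loewner_scalar_diag h.
have cS0 : #|[set x : 'I_n | (x < k)%N]| == k.
  rewrite -[X in _ == X]card_ord -(card_imset _ (@widen_ord_inj _ _ kn)).
  apply/eqP/eq_card => x; rewrite inE; apply/idP/imsetP => [xS|[y _ ->]].
    by exists (Ordinal xS) => //; apply: val_inj.
  exact: (ltn_ord y).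
pose S0 : ksub n k := exist _ [set x : 'I_n | (x < k)%N] cS0.
have := h (compound_unitary k uV) (enum_rank S0).
rewrite mxE enum_rankK /= (eq_bigl (fun x : 'I_n => (x < k)%N)).
  by rewrite -/E; lra.
by move=> x; rewrite inE.
Qed.

Definition eigs n (X : 'M[C]_n) : seq C :=
  sort >=%R (sval (closed_field_poly_normal (char_poly X))).

Lemma eigs_spec n (U : 'M[C]_n) d : U \is unitarymx -> decreasing d ->
  eigs (spec U d) = [seq iota (d 0 i) | i : 'I_n].
Proof.
move=> uU dd; rewrite /eigs; case: closed_field_poly_normal => s /= es.
have {}es : \prod_(z <- s) ('X - z%:P) =
    \prod_(z <- [seq iota (d 0 i) | i : 'I_n]) ('X - z%:P).
  have := es; rewrite (monicP (char_poly_monic _)) scale1r => <-.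
  rewrite /spectral_mx -mulmxA char_poly_mulC mulmxtVK // char_poly_trig.
    by rewrite big_image /=; apply: eq_bigr => i _; rewrite !mxE eqxx.
  exact: diag_mx_is_trig.
have ps := prod_XsubC_eq es.
have ge_trans : transitive (>=%R : rel C).
  by move=> x y z xy yz; apply: le_trans yz xy.
(* The order of C is only partial; sorting is meaningful because all the roots are real. *)
have sr : all (mem Num.real) s.
  apply/allP=> z; rewrite (perm_mem ps) => /imageP[i _ ->].
  by apply/CrealP; apply: iota_conj.
apply: (sorted_eq ge_trans).
- by move=> x y; rewrite andbC => /le_anti.
- apply: sort_sorted_in sr => x y xr yr; rewrite orbC; exact: real_leVge.
- apply/(sortedP 0) => i; rewrite size_image card_ord => lt_in.
  have lt_in' := ltnW lt_in; pose a := Ordinal lt_in'; pose b := Ordinal lt_in.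
  rewrite !(nth_map b) -?enumT ?size_enum_ord //.
  have -> : nth b (enum 'I_n) i = a := nth_ord_enum b a.
  have -> : nth b (enum 'I_n) i.+1 = b := nth_ord_enum b b.
  rewrite /= ler_embed.
  exact: (dd a b (leqnSn _)).
- by rewrite perm_sort.
Qed.

Lemma eigs_prod n (U : 'M[C]_n) d k : U \is unitarymx -> decreasing d ->
  (k <= n)%N ->
  \prod_(j < k) nth 0 (eigs (spec U d)) j =
  iota (\prod_(x : 'I_n | (x < k)%N) d 0 x).
Proof.
move=> uU dd kn; rewrite eigs_spec // rmorph_prod /=.
rewrite (big_ord_widen n (nth 0 [seq iota (d 0 i) | i : 'I_n]) kn).
apply: eq_bigr => i _; rewrite (nth_map i) -?enumT ?size_enum_ord //.
by rewrite nth_ord_enum.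
Qed.

Lemma eigs_mulC n (A B : 'M[C]_n) : eigs (A *m B) = eigs (B *m A).
Proof. by rewrite /eigs char_poly_mulC. Qed.

Lemma det_mxpow n (A : 'M[C]_n) : psd A ->
  exists2 a, 0 <= a & forall s, \det (mxpow A s) = iota (a `^ s).
Proof.
move=> /(psd_specE iota)[U [d [uU d0 _ eP]]].
exists (\prod_i d 0 i) => [|s]; first exact: prodr_ge0.
rewrite eP /spectral_mx -mulmxA det_mulmx mulrC -det_mulmx mulmxtVK //.
rewrite det_diag powR_prod // rmorph_prod.
by apply: eq_bigr => i _; rewrite !mxE.
Qed.

(** Both sides are homogeneous of degree q in B, so scaling B by c^(-1/q) reduces to c = 1. *)
Lemma norm_inequality n (A B : 'M[C]_n) (q r c : R) : psd A -> psd B ->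
  1 <= q -> 0 <= r -> q <= 2 \/ r * (q - 2) <= q -> 0 < c ->
  mxpow A ((r + q) / 2) *m mxpow B q *m mxpow A ((r + q) / 2) ⪯ (iota c)%:M ->
  mxpow A (r / 2) *m
    mxpow (mxpow A (1 / 2) *m B *m mxpow A (1 / 2)) q *m mxpow A (r / 2)
  ⪯ (iota c)%:M.
Proof.
move=> pA pB q1 r0 hq c0 h.
have q0 : 0 < q by lra.
set t := c^-1 `^ q^-1; have t0 : 0 <= t by exact: powR_ge0.
have ci0 : 0 <= c^-1 by rewrite invr_ge0 ltW.
have ci0' : 0 <= iota c^-1 by rewrite iota_ge0.
have tq : t `^ q = c^-1.
  by rewrite /t -powRrM mulVf ?lt0r_neq0 // powRr1.
have cK : iota c * iota c^-1 = 1 by rewrite -rmorphM mulfV ?rmorph1 // lt0r_neq0.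
pose B' := iota t *: B.
have pB' : psd B' by apply: psdZ => //; rewrite iota_ge0.
have h' : mxpow A ((r + q) / 2) *m mxpow B' q *m mxpow A ((r + q) / 2) ⪯ 1%:M.
  rewrite mxpowZ // tq -scalemxAr -scalemxAl.
  have := loewnerZ ci0' h.
  by rewrite scale_scalar_mx [iota c^-1 * _]mulrC cK.
have : mxpow A (r / 2) *m
    mxpow (mxpow A (1 / 2) *m B' *m mxpow A (1 / 2)) q *m mxpow A (r / 2)
    ⪯ 1%:M.
  have [q2|q2] := leP q 2; first exact: norm_inequality_le2.
  by apply: norm_inequality_ge2 => //; [exact: ltW|case: hq => //; lra].
rewrite /B' -scalemxAr -scalemxAl mxpowZ //; last exact: psd_sandwich.
rewrite tq -scalemxAr -scalemxAl.
have c0' : 0 <= iota c by rewrite iota_ge0 ltW.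
by move/(loewnerZ c0'); rewrite scalerA cK scale1r scalemx1.
Qed.

Lemma log_majorization n (A B : 'M[C]_n) (q r : R) : psd A -> psd B ->
  1 <= q -> 0 <= r -> q <= 2 \/ r * (q - 2) <= q ->
  let X := mxpow A (1 / 2) *m B *m mxpow A (1 / 2) in
  (forall k, (k <= n)%N ->
     \prod_(j < k) nth 0 (eigs (mxpow A r *m mxpow X q)) j <=
     \prod_(j < k) nth 0 (eigs (mxpow A (r + q) *m mxpow B q)) j) /\
  \det (mxpow A (r + q) *m mxpow B q) = \det (mxpow A r *m mxpow X q).
Proof.
move=> pA pB q1 r0 hq X; have q0 : 0 < q by lra.
have pX : psd X by exact: psd_sandwich.
have half s : 0 <= s -> mxpow A s = mxpow A (s / 2) *m mxpow A (s / 2).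
  by move=> s0; rewrite -mxpowD ?divr_ge0 //; congr mxpow; field.
(* Cyclicity replaces a product that need not be Hermitian by a sandwich, positive semidefinite when
   E is. *)
have eE s (E : 'M[C]_n) : 0 <= s ->
    eigs (mxpow A s *m E) = eigs (mxpow A (s / 2) *m E *m mxpow A (s / 2)).
  by move=> s0; rewrite {1}(half s s0) -mulmxA eigs_mulC.
split=> [k kn|].
  rewrite !eE ?addr_ge0 ?(ltW q0) //.
  have [U [d [uU d0 dd eH]]] :=
    psd_decreasing (psd_sandwich iota ((r + q) / 2) pA (mxpow_psd iota q pB)).
  have [V [e [uV e0 de eK]]] :=
    psd_decreasing (psd_sandwich iota (r / 2) pA (mxpow_psd iota q pX)).
  rewrite eH eK !eigs_prod // ler_embed.
  apply: (compound_top_prod uU uV d0 dd kn) => c c0; rewrite -eH -eK.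
  (* Compounds commute with products and powers, so the norm inequality is applied to the compounds
     of A and B. *)
  rewrite !compoundM !compound_mxpow //.
  rewrite [compound k X]compoundM compoundM compound_mxpow //.
  by apply: norm_inequality => //; apply: compound_psd.
have [a a0 ea] := det_mxpow pA; have [b b0 eb] := det_mxpow pB.
have [x x0 ex] := det_mxpow pX.
have eX : x = a * b.
  apply: (can_inj (embedK iota)).
  rewrite -[x]powRr1 // -ex mxpow1 // /X !det_mulmx !ea -[in \det B](mxpow1 iota pB).
  rewrite eb powRr1 // -!rmorphM mulrAC -powRD_ge0 ?divr_ge0 //.
  have -> : 1 / 2 + 1 / 2 = 1 :> R by field.
  by rewrite powRr1.
rewrite !det_mulmx !ea eb ex -!rmorphM eX powRM // powRD_ge0 ?(ltW q0) //.
by rewrite mulrA.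
Qed.

End Compounds.

(** * The counterexample *)

Section Counterexample.
Variables (R : realType) (C : numClosedFieldType) (iota : real_embedding R C).
Implicit Types (n k : nat) (s t c : R).
Local Notation mxpow := (mxpow iota).
Local Notation spec := (spectral_mx iota).
Local Notation cmx := (map_mx iota).

Lemma psd_mul_tr_ge0 n (P Q : 'M[C]_n) : psd P -> psd Q -> 0 <= \tr (P *m Q).
Proof.
move=> /(psd_specE iota)[U [d [uU d0 -> _]]] pQ.
rewrite /spectral_mx -!mulmxA mxtrace_mulC -!mulmxA.
have pE : psd (U *m (Q *m U^t*)).
  by have := psd_conj (U^t*) pQ; rewrite trmxCK mulmxA.
rewrite /mxtrace sumr_ge0 // => i _; rewrite mul_diag_mx !mxE.
rewrite mulr_ge0 ?iota_ge0 //.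
have := pE.2 (delta_mx i 0); rewrite /qform trmx_delta map_delta_mx.
by rewrite -rowE -colE !mxE.
Qed.

Lemma spec_pd n (U : 'M[C]_n) (d : 'rV[R]_n) x : U \is unitarymx ->
  (forall i, 0 < d 0 i) -> x != 0 -> 0 < qform (spec U d) x.
Proof.
move=> uU d0 x0; rewrite lt_def (spec_psd iota U (fun i => ltW (d0 i))).2 andbT.
apply: contraNneq x0; rewrite spec_form => /psumr_eq0P Ux.
rewrite -[x]mul1mx -(unitarymxK uU) -mulmxA.
suff -> : U *m x = 0 by rewrite mulmx0.
have iota0 i : 0 < iota (d 0 i).
  by rewrite lt_def iota_ge0 ltW // andbT -(rmorph0 iota) (inj_eq (@iota_inj _ _ iota))
     lt0r_neq0.
apply/colP=> i; rewrite [RHS]mxE; apply/eqP; rewrite -normr_eq0 -sqrf_eq0.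
have /eqP := Ux (fun j _ => mulr_ge0 (ltW (iota0 j)) (exprn_ge0 2 (normr_ge0 _))) i isT.
by rewrite mulf_eq0 (negbTE (lt0r_neq0 (iota0 i))).
Qed.

Lemma cmx_unitary n (O : 'M[R]_n) : O *m O^T = 1%:M -> cmx O \is unitarymx.
Proof.
move=> hO; apply/unitarymxP.
have -> : (cmx O)^t* = cmx O^T.
  by apply/matrixP=> i j; rewrite !mxE; apply: iota_conj.
by rewrite -map_mxM hO map_mx1.
Qed.

Lemma spec_real n (O : 'M[R]_n) d : spec (cmx O) d =
  cmx (\matrix_(i, j) \sum_l O l i * d 0 l * O l j).
Proof.
apply/matrixP=> i j; rewrite specE !mxE rmorph_sum.
by apply: eq_bigr => l _; rewrite !mxE !rmorphM; congr (_ * _ * _); apply: iota_conj.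
Qed.

Lemma mxpow_nat n (X : 'M[C]_n) m : psd X ->
  mxpow X m.+1%:R = X *m mxpow X m%:R.
Proof. by move=> pX; rewrite -natr1 addrC mxpowD // mxpow1. Qed.

(* The left-hand side is the weight of the walk i -> j -> ... -> j -> i. *)
Lemma mxpow_walk n (X : 'M[R]_n) m i j : psd (cmx X) -> (forall i j, 0 <= X i j) ->
  iota (X i j * X j j ^+ m * X j i) <= mxpow (cmx X) m.+2%:R i i.
Proof.
move=> pX X0.
have [Y eY] : exists Y : nat -> 'M[R]_n,
    forall m, mxpow (cmx X) m%:R = cmx (Y m) /\ Y m.+1 = X *m Y m.
  exists (fun m => iter m (mulmx X) 1%:M); elim=> [|l [IH _]]; split=> //.
    by rewrite mxpow0 // map_mx1.
  by rewrite mxpow_nat // IH -map_mxM.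
have Y1 : Y 1%N = X.
  rewrite -[RHS]mulmx1 (eY 0%N).2; congr (_ *m _).
  have := (eY 0%N).1; rewrite mxpow0 // => h; apply/matrixP=> a b.
  have /matrixP/(_ a b) := h.
  by rewrite -(map_mx1 iota) [in LHS]mxE [in RHS]mxE => /iota_inj.
have Y0 l a b : 0 <= Y l.+1 a b.
  elim: l a b => [|l IH] a b; first by rewrite Y1.
  by rewrite (eY _).2 mxE sumr_ge0 // => x _; rewrite mulr_ge0.
have step l a b x : X a x * Y l.+1 x b <= Y l.+2 a b.
  rewrite (eY l.+1).2 mxE (bigD1 x) //= lerDl sumr_ge0 // => z _.
  by rewrite mulr_ge0.
have Yj l : X j j ^+ l * X j i <= Y l.+1 j i.
  elim: l => [|l IH]; first by rewrite expr0 mul1r Y1.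
  by apply: le_trans (step _ _ _ j); rewrite exprS -mulrA ler_wpM2l.
rewrite (eY _).1 mxE ler_embed; apply: le_trans (step _ _ _ j).
by rewrite -mulrA ler_wpM2l.
Qed.

Lemma powR_le_scale (x M q m : R) : 0 <= x <= M -> 0 < M -> 0 <= q <= m ->
  M `^ (q - m) * x `^ m <= x `^ q.
Proof.
move=> /andP[x0 xM] M0 /andP[q0 qm].
have mq : 0 <= m - q by rewrite subr_ge0.
have -> : m = q + (m - q) by ring.
rewrite (powRD_ge0 x q0 mq) mulrCA ler_piMr ?powR_ge0 //.
have -> : q - (q + (m - q)) = - (m - q) by ring.
rewrite powRN ler_pdivrMl ?powR_gt0 // mulr1.
by apply: ge0_ler_powR; rewrite ?nnegrE // ltW.
Qed.

(** Eigenvalues of X are at most its trace, hence at most M. This trades the real exponent q for a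
    larger integer one, to which the walk estimate applies. *)
Lemma mxpow_diag_ge n (X : 'M[C]_n) M q m i : psd X -> 0 < M ->
  \tr X <= iota M -> 0 <= q <= m ->
  iota (M `^ (q - m)) * mxpow X m i i <= mxpow X q i i.
Proof.
move=> /(psd_specE iota)[V [e [uV e0 eX eP]]] M0 trX qm.
have eM l : e 0 l <= M.
  rewrite -(ler_embed iota); apply: le_trans trX.
  rewrite eX /spectral_mx -mulmxA mxtrace_mulC mulmxtVK // mxtrace_diag.
  rewrite (bigD1 l) //= mxE lerDl sumr_ge0 // => j _.
  by rewrite mxE iota_ge0.
rewrite !eP !specE mulr_sumr; apply: ler_sum => l _.
rewrite !mxE; have := mul_conjC_ge0 (V l i).
move: (V l i) (V l i)^* => z w zw.
have -> a b : iota a * (w * iota b * z) = iota (a * b) * (z * w).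
  by rewrite rmorphM; ring.
have -> a : w * iota a * z = iota a * (z * w) by ring.
apply: ler_wpM2r => //.
by rewrite ler_embed powR_le_scale // e0 eM.
Qed.

End Counterexample.

(** * Explicit real 3 x 3 matrices *)

Section Rotations.
Variable R : realType.

(** The real counterpart of [spectral_mx]: the entries of O^T diag(d) O. *)
Definition rspec n (O : 'M[R]_n) (d : 'rV[R]_n) : 'M[R]_n :=
  \matrix_(i, j) \sum_l O l i * d 0 l * O l j.

Let o0 : 'I_3 := @Ordinal 3 0 isT.
Let o1 : 'I_3 := @Ordinal 3 1 isT.
Let o2 : 'I_3 := @Ordinal 3 2 isT.

Lemma sum3 (V : zmodType) (F : 'I_3 -> V) : \sum_i F i = F o0 + F o1 + F o2.
Proof.
rewrite !big_ord_recl big_ord0 addr0 addrA.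
by congr (F _ + F _ + F _); apply: val_inj.
Qed.

Lemma ord3P (P : 'I_3 -> Prop) : P o0 -> P o1 -> P o2 -> forall i, P i.
Proof.
move=> P0 P1 P2 [[|[|[|i]]] hi] //; [move: P0|move: P1|move: P2];
  by congr (P _); apply: val_inj.
Qed.

Definition row3 (a b c : R) : 'rV[R]_3 :=
  \row_j match nat_of_ord j with 0%N => a | 1%N => b | _ => c end.

(** The 3-4-5 triangle keeps all entries rational. [rotA] mixes the last two axes, [rotB] the first
    and the last, so that the first two axes communicate only through the third. *)
Definition rotA : 'M[R]_3 := \matrix_(i, j)
  match nat_of_ord i, nat_of_ord j with
  | 0%N, 0%N => 1 | 1%N, 1%N => 3 / 5 | 1%N, 2%N => 4 / 5
  | 2%N, 1%N => - (4 / 5) | 2%N, 2%N => 3 / 5 | _, _ => 0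
  end.

Definition rotB : 'M[R]_3 := \matrix_(i, j)
  match nat_of_ord i, nat_of_ord j with
  | 1%N, 1%N => 1 | 0%N, 0%N => 3 / 5 | 0%N, 2%N => 4 / 5
  | 2%N, 0%N => - (4 / 5) | 2%N, 2%N => 3 / 5 | _, _ => 0
  end.

Lemma rotA_orth : rotA *m rotA^T = 1%:M.
Proof.
by apply/matrixP; do 2![elim/ord3P]; rewrite !mxE sum3 !mxE /=; field.
Qed.

Lemma rotB_orth : rotB *m rotB^T = 1%:M.
Proof.
by apply/matrixP; do 2![elim/ord3P]; rewrite !mxE sum3 !mxE /=; field.
Qed.

Definition matA (a b c : R) : 'M[R]_3 := \matrix_(i, j)
  match nat_of_ord i, nat_of_ord j with
  | 0%N, 0%N => a | 1%N, 1%N => (9 * b + 16 * c) / 25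
  | 2%N, 2%N => (16 * b + 9 * c) / 25
  | 0%N, _ | _, 0%N => 0 | _, _ => 12 / 25 * (b - c)
  end.

Definition matB (a b c : R) : 'M[R]_3 := \matrix_(i, j)
  match nat_of_ord i, nat_of_ord j with
  | 1%N, 1%N => b | 0%N, 0%N => (9 * a + 16 * c) / 25
  | 2%N, 2%N => (16 * a + 9 * c) / 25
  | 1%N, _ | _, 1%N => 0 | _, _ => 12 / 25 * (a - c)
  end.

Lemma rspecA a b c : rspec rotA (row3 a b c) = matA a b c.
Proof.
by apply/matrixP; do 2![elim/ord3P]; rewrite !mxE sum3 !mxE /=; field.
Qed.

Lemma rspecB a b c : rspec rotB (row3 a b c) = matB a b c.
Proof.
by apply/matrixP; do 2![elim/ord3P]; rewrite !mxE sum3 !mxE /=; field.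
Qed.

(** The off-diagonal entries sit in different places, so only the diagonals contribute. Each of the
    three terms is at most 1; for the large entry a this uses a b <= 1. *)
Lemma trAB_le3 a t b c : 0 <= a -> a * b <= 1 -> 0 <= t <= 1 -> 0 <= c <= b ->
  b <= 1 -> \tr (matA a 1 t *m matB b 1 c) <= 3.
Proof.
move=> a0 ab /andP[t0 t1] /andP[c0 cb] b1.
rewrite /mxtrace sum3 !mxE !sum3 !mxE /=.
have ac : a * c <= a * b by rewrite ler_wpM2l.
have p : (16 * b + 9 * c) / 25 * (16 * 1 + 9 * t) / 25 <= 1 by nra.
nra.
Qed.

Lemma matA_ge0 a b c i j : 0 <= a -> 0 <= c <= b -> 0 <= matA a b c i j.
Proof.
move=> a0 /andP[c0 cb]; move: i j; do 2![elim/ord3P]; rewrite !mxE //=; lra.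
Qed.

Lemma matB_ge0 a b c i j : 0 <= b -> 0 <= c <= a -> 0 <= matB a b c i j.
Proof.
move=> a0 /andP[c0 cb]; move: i j; do 2![elim/ord3P]; rewrite !mxE //=; lra.
Qed.

(** A^(1/2) B A^(1/2) for the counterexample, with h = N^(1/2) and t = (1/4)^(1/2). The entries
    computed below are those met by the walk 0, 1, ..., 1, 0. *)
Definition sandwich (h t b c : R) : 'M[R]_3 :=
  matA h 1 t *m matB b 1 c *m matA h 1 t.

Lemma sandwich_ge0 h t b c i j : 0 <= h -> 0 <= t <= 1 -> 0 <= c <= b ->
  0 <= sandwich h t b c i j.
Proof.
move=> h0 t01 cb; rewrite mxE sumr_ge0 // => k _.
rewrite mulr_ge0 ?matA_ge0 // mxE sumr_ge0 // => l _.
by rewrite mulr_ge0 ?matA_ge0 ?matB_ge0.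
Qed.

Lemma sandwich01 h t b c : sandwich h t b c o0 o1 =
  h * (b - c) * ((12 / 25) ^+ 2 * (1 - t)).
Proof. by rewrite !mxE !sum3 !mxE !sum3 !mxE /=; field. Qed.

Lemma sandwich10 h t b c : sandwich h t b c o1 o0 =
  h * (b - c) * ((12 / 25) ^+ 2 * (1 - t)).
Proof. by rewrite !mxE !sum3 !mxE !sum3 !mxE /=; field. Qed.

Lemma sandwich11 h t b c : 0 <= t <= 1 -> 0 <= c <= b ->
  (9 / 25) ^+ 2 <= sandwich h t b c o1 o1.
Proof.
move=> /andP[t0 t1] /andP[c0 cb]; rewrite !mxE !sum3 !mxE !sum3 !mxE /=.
have : 0 <= (12 / 25 * (1 - t)) ^+ 2 * ((16 * b + 9 * c) / 25).
  by rewrite mulr_ge0 ?sqr_ge0 //; lra.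
by nra.
Qed.

End Rotations.

(** * Growth of the trace ratio *)

Section TraceCounterexample.
Variables (R : realType) (C : numClosedFieldType) (iota : real_embedding R C).
Local Notation mxpow := (mxpow iota).
Local Notation spec := (spectral_mx iota).
Local Notation cmx := (map_mx iota).
Let o0 : 'I_3 := @Ordinal 3 0 isT.
Let o1 : 'I_3 := @Ordinal 3 1 isT.

Lemma spec_rspec n (O : 'M[R]_n) d : spec (cmx O) d = cmx (rspec O d).
Proof. exact: spec_real. Qed.

Lemma map_row3 (f : R -> R) a b c :
  map_mx f (row3 a b c) = row3 (f a) (f b) (f c).
Proof. by apply/rowP; elim/ord3P; rewrite !mxE. Qed.

Lemma row3_gt0 (a b c : R) : 0 < a -> 0 < b -> 0 < c ->
  forall i, 0 < row3 a b c 0 i.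
Proof. by move=> a0 b0 c0; elim/ord3P; rewrite mxE. Qed.

Lemma growth_exponent (N q r : R) : 1 <= N -> 2 < q ->
  let b := N `^ (- ((r + q) / q)) in
  N `^ r * (N `^ (1 / 2) * b) ^+ 2 = N `^ (r - 1 - 2 * r / q) /\
  N `^ (r + q) * b `^ q = 1.
Proof.
move=> N1 q2 b; have q0 : q != 0 by apply: lt0r_neq0; lra.
have D x y : N `^ x * N `^ y = N `^ (x + y).
  by rewrite powRD //; apply/implyP => _; apply: lt0r_neq0; lra.
split; last first.
  rewrite /b -powRrM D; have -> : r + q + - ((r + q) / q) * q = 0 by field.
  exact: powRr0.
rewrite /b D expr2 !D; congr (_ `^ _); field; exact: q0.
Qed.

(** The growth exponent e = (r (q - 2) - q) / q is positive, so a large N beats any constant K. The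
    target 9 is the factor 3 of the trace counterexample times the bound 3 on its left-hand
    trace. *)
Lemma growth_parameters (q r K : R) : 2 < q -> q < r * (q - 2) -> 0 < K ->
  exists N b : R, [/\ 1 <= N, 0 < b <= 1, N * b <= 1,
    N `^ (r + q) * b `^ q = 1 & 9 < N `^ r * (N `^ (1 / 2) * b) ^+ 2 * K].
Proof.
move=> q2 hr K0; have q0 : 0 < q by lra.
have r0 : 0 < r by nra.
set e := r - 1 - 2 * r / q.
have e0 : 0 < e.
  have -> : e = (r * (q - 2) - q) / q by rewrite /e; field; rewrite lt0r_neq0.
  by rewrite divr_gt0 ?subr_gt0.
have K9 : 0 < 9 / K by rewrite divr_gt0.
have [N N1 Ne] : exists2 N, 1 <= N & N `^ e = 9 / K + 1.
  exists ((9 / K + 1) `^ (1 / e)).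
    have e1 : 0 <= 1 / e by rewrite divr_ge0 ?(ltW e0).
    have := ge0_ler_powR e1 (x := 1) (y := 9 / K + 1); rewrite powR1 !nnegrE.
    by apply; lra.
  by rewrite -powRrM div1r mulVf ?powRr1 ?lt0r_neq0 //; lra.
have N0 : 0 < N by lra.
have [hN hNq] := growth_exponent r N1 q2; rewrite -/e in hN.
exists N, (N `^ (- ((r + q) / q))); split=> //.
- rewrite powR_gt0 //= -[X in _ <= X](powRr0 N); apply: ler_powR => //.
  by rewrite oppr_le0 divr_ge0 ?addr_ge0 // ltW.
- rewrite -{1}[N]powRr1 ?(ltW N0) // -powRD; last first.
    by apply/implyP => _; rewrite lt0r_neq0.
  rewrite -[X in _ <= X](powRr0 N); apply: ler_powR => //.
  have -> : 1 + - ((r + q) / q) = - (r / q) by field; rewrite lt0r_neq0.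
  by rewrite oppr_le0 divr_ge0 // ltW.
- by rewrite hN Ne mulrDl divfK ?lt0r_neq0 // mul1r; lra.
Qed.

(* A is N on the first axis plus a rotated diag(1, 1/4), and B is 1 on the second
   axis plus a rotated diag(b, b/2), with b^q = N^-(r+q): this keeps the
   left-hand trace bounded while the right-hand one is at least a constant times
   N^(r - 1 - 2r/q). All the entries of A^(1/2), B are nonnegative, so there is
   no cancellation in the powers of A^(1/2) B A^(1/2). *)
Lemma trace_counterexample (q r : R) : 2 < q -> q < r * (q - 2) ->
  exists (U V : 'M[C]_3) (d e : 'rV[R]_3),
  [/\ U \is unitarymx, V \is unitarymx,
      forall i, 0 < d 0 i, forall i, 0 < e 0 i &
      let A := spec U d in let B := spec V e in
      3 * \tr (mxpow A (r + q) *m mxpow B q) <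
      \tr (mxpow A r *m mxpow (mxpow A (1 / 2) *m B *m mxpow A (1 / 2)) q)].
Proof.
move=> q2 hr; have q0 : 0 < q by lra.
have r0 : 0 < r by nra.
have [m qm] : exists m : nat, 0 <= q <= m.+2%:R.
  exists (Num.bound q); rewrite ltW //=.
  apply: (@le_trans _ _ (Num.bound q)%:R); last by rewrite ler_nat ltnW.
  by apply/ltW/archi_boundP/ltW.
pose t (s : R) := (1 / 4) `^ s.
have t01 s : 0 <= s -> 0 <= t s <= 1.
  move=> s0; rewrite /t powR_ge0 /=.
  have := ge0_ler_powR s0 (x := 1 / 4) (y := 1); rewrite powR1 !nnegrE.
  by apply; lra.
have h0 : 0 < 1 / 2 :> R by lra.
have th1 : t (1 / 2) < 1.
  have := gt0_ltr_powR h0 (x := 1 / 4) (y := 1); rewrite powR1 !nnegrE.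
  by apply; lra.
have [kappa kappa0 ekappa] :
    exists2 kappa, 0 < kappa & kappa = (12 / 25) ^+ 2 * (1 - t (1 / 2)).
  by eexists; last reflexivity; rewrite mulr_gt0 ?exprn_gt0 ?subr_gt0 //; lra.
(* The constants of the lower bound, fixed before N: the first factor trades q for m + 2,
   [kappa / 2] comes from the entries (0, 1) and (1, 0), and (9/25)^2 bounds the entry (1, 1) on the
   m loops. *)
have [K K0 eK] : exists2 K, 0 < K &
    K = 3 `^ (q - m.+2%:R) * (kappa / 2) ^+ 2 * ((9 / 25) ^+ 2) ^+ m.
  eexists; last reflexivity.
  by rewrite !mulr_gt0 ?powR_gt0 ?exprn_gt0 //; lra.
have [N [b [N1 /andP[b0 b1] Nb hNq hK]]] := growth_parameters q2 hr K0.
have N0 : 0 < N by lra.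
have uA := cmx_unitary iota (rotA_orth R).
have uB := cmx_unitary iota (rotB_orth R).
have dA : forall i, 0 < row3 N 1 (1 / 4) 0 i by apply: row3_gt0; lra.
have dB : forall i, 0 < row3 b 1 (b / 2) 0 i by apply: row3_gt0; lra.
exists (cmx (rotA R)), (cmx (rotB R)), (row3 N 1 (1 / 4)), (row3 b 1 (b / 2)).
split=> // A B.
have dA' i := ltW (dA i); have dB' i := ltW (dB i).
have pA : psd A by apply: spec_psd.
have pB : psd B by apply: spec_psd.
have eA s : mxpow A s = cmx (matA (N `^ s) 1 (t s)).
  by rewrite /A mxpow_spec // map_row3 powR1 spec_rspec rspecA.
have eB s : mxpow B s = cmx (matB (b `^ s) 1 ((b / 2) `^ s)).
  by rewrite /B mxpow_spec // map_row3 powR1 spec_rspec rspecB.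
have eX : mxpow A (1 / 2) *m B *m mxpow A (1 / 2) =
    cmx (sandwich (N `^ (1 / 2)) (t (1 / 2)) b (b / 2)).
  by rewrite eA /B spec_rspec rspecB -!map_mxM.
set Xr := sandwich _ _ _ _ in eX.
have pX : psd (cmx Xr) by rewrite -eX; apply: psd_sandwich.
have hb : 0 <= b / 2 <= b by apply/andP; split; lra.
have X0 i j : 0 <= Xr i j.
  apply: sandwich_ge0 hb; first exact: powR_ge0.
  exact: t01 (ltW h0).
(* By cyclicity this trace is that of A B, bounded as the left-hand side is. *)
have trX : \tr (cmx Xr) <= iota 3.
  have -> : \tr (cmx Xr) = \tr (mxpow A 1 *m mxpow B 1).
    rewrite -eX mxtrace_mulC mulmxA -mxpowD ?(ltW h0) //.
    have -> : 1 / 2 + 1 / 2 = 1 :> R by field.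
    by rewrite (mxpow1 iota pB).
  rewrite eA eB -map_mxM trace_map_mx ler_embed.
  have [hb0 _] := andP hb; rewrite !powRr1 ?(ltW N0) ?(ltW b0) //.
  exact: trAB_le3 (ltW N0) Nb (t01 1 ler01) hb b1.
rewrite eX.
have lhs : \tr (mxpow A (r + q) *m mxpow B q) <= iota 3.
  rewrite eA eB -map_mxM trace_map_mx ler_embed.
  have rq0 : 0 <= r + q by rewrite addr_ge0 // ltW.
  apply: trAB_le3 (powR_ge0 _ _) _ (t01 _ rq0) _ _; first by rewrite hNq.
    have [hb0 hbb] := andP hb; rewrite powR_ge0 /=.
    by apply: ge0_ler_powR; rewrite ?nnegrE // ltW.
  have := ge0_ler_powR (ltW q0) (x := b) (y := 1); rewrite powR1 !nnegrE.
  by apply; rewrite // ltW.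
(* A^r dominates N^r times the projection onto the first axis. *)
have rhs : iota (N `^ r) * mxpow (cmx Xr) q o0 o0 <=
    \tr (mxpow A r *m mxpow (cmx Xr) q).
  rewrite -subr_ge0.
  have -> : iota (N `^ r) * mxpow (cmx Xr) q o0 o0 =
      \tr (cmx (matA (N `^ r) 0 0) *m mxpow (cmx Xr) q).
    rewrite /mxtrace sum3 !mxE !sum3 !mxE /=.
    by rewrite !(subrr, mulr0, mul0r, addr0, rmorph0).
  rewrite -linearB -mulmxBl; apply: (psd_mul_tr_ge0 iota); last exact: mxpow_psd.
  rewrite eA.
  have -> : cmx (matA (N `^ r) 1 (t r)) - cmx (matA (N `^ r) 0 0) =
      spec (cmx (rotA R)) (row3 0 1 (t r)).
    rewrite spec_rspec rspecA -map_mxB; congr (map_mx iota _).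
    by apply/matrixP; do 2![elim/ord3P]; rewrite !mxE /=; field.
  by apply: spec_psd => //; elim/ord3P; rewrite mxE //= powR_ge0.
apply: lt_le_trans rhs.
have i3 : (3 : C) = iota 3 by rewrite rmorph_nat.
apply: (@le_lt_trans _ _ (iota 9)).
  have -> : iota 9 = 3 * iota 3 by rewrite i3 -rmorphM; congr (iota _); ring.
  by rewrite ler_wpM2l.
have M3 : 0 < 3 :> R by lra.
have h1 := mxpow_diag_ge o0 pX M3 trX qm.
have h2 := mxpow_walk m o0 o1 pX X0.
set w := Xr o0 o1 * Xr o1 o1 ^+ m * Xr o1 o0 in h2.
have hw : (N `^ (1 / 2) * b * (kappa / 2)) ^+ 2 * ((9 / 25) ^+ 2) ^+ m <= w.
  rewrite /w sandwich01 sandwich10 -ekappa.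
  have -> : N `^ (1 / 2) * (b - b / 2) * kappa = N `^ (1 / 2) * b * (kappa / 2).
    by field.
  rewrite [leRHS]mulrAC -expr2; apply: ler_wpM2l; first exact: sqr_ge0.
  by apply: lerXn2r; rewrite ?nnegrE ?X0 ?sqr_ge0 // sandwich11 // t01 // ltW.
have i0 x : 0 <= x -> 0 <= iota x by rewrite iota_ge0.
apply: lt_le_trans (ler_wpM2l (i0 _ (powR_ge0 _ _)) h1).
apply: lt_le_trans (ler_wpM2l (i0 _ (powR_ge0 _ _)) (ler_wpM2l (i0 _ (powR_ge0 _ _)) h2)).
rewrite -!rmorphM /=.
rewrite lt_neqAle ler_embed (inj_eq (@iota_inj _ _ iota)) -lt_neqAle.
have p3 : 0 <= N `^ r * 3 `^ (q - m.+2%:R) by rewrite mulr_ge0 ?powR_ge0.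
rewrite mulrA; apply: lt_le_trans (ler_wpM2l p3 hw).
have -> : N `^ r * 3 `^ (q - m.+2%:R) *
    ((N `^ (1 / 2) * b * (kappa / 2)) ^+ 2 * ((9 / 25) ^+ 2) ^+ m) =
    N `^ r * (N `^ (1 / 2) * b) ^+ 2 * K.
  by rewrite eK [(_ * b * _) ^+ 2]exprMn; ring.
exact: hK.
Qed.

End TraceCounterexample.

(** * General p *)

Section Rescaling.
Variables (R : realType) (C : numClosedFieldType) (iota : real_embedding R C).
Local Notation mxpow := (mxpow iota).
Local Notation spec := (spectral_mx iota).

Definition lhs_mx (q r : R) n (A B : 'M[C]_n) : 'M[C]_n :=
  mxpow A (r + q) *m mxpow B q.

Definition rhs_mx (p q r : R) n (A B : 'M[C]_n) : 'M[C]_n :=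
  mxpow A r *m
    mxpow (mxpow A (p / 2) *m mxpow B p *m mxpow A (p / 2)) (q / p).

(** Replacing A, B by A^p, B^p turns the parameters (p, q, r) into (1, q / p, r / p). *)
Lemma lhs_mx_scale (p q r : R) n (A B : 'M[C]_n) : p != 0 -> psd A -> psd B ->
  lhs_mx (q / p) (r / p) (mxpow A p) (mxpow B p) = lhs_mx q r A B.
Proof.
move=> p0 pA pB; rewrite /lhs_mx !mxpow_mxpow //.
by congr (mxpow _ _ *m mxpow _ _); field.
Qed.

Lemma rhs_mx_scale (p q r : R) n (A B : 'M[C]_n) : p != 0 -> psd A -> psd B ->
  rhs_mx 1 (q / p) (r / p) (mxpow A p) (mxpow B p) = rhs_mx p q r A B.
Proof.
move=> p0 pA pB; rewrite /rhs_mx !mxpow_mxpow // mulr1 divr1.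
have -> : p * (1 / 2) = p / 2 by field.
by have -> : p * (r / p) = r by field.
Qed.

Lemma log_majorization_pqr (p q r : R) n (A B : 'M[C]_n) :
  0 < p -> p <= q -> 0 <= r ->
  q <= 2 * p \/ 2 * p < q /\ r <= p * q / (q - 2 * p) -> psd A -> psd B ->
  (forall k, (k <= n)%N ->
     \prod_(j < k) nth 0 (eigs (rhs_mx p q r A B)) j <=
     \prod_(j < k) nth 0 (eigs (lhs_mx q r A B)) j) /\
  \det (lhs_mx q r A B) = \det (rhs_mx p q r A B).
Proof.
move=> p0 pq r0 hpq pA pB; have pn0 := lt0r_neq0 p0.
rewrite -(lhs_mx_scale _ _ pn0 pA pB) -(rhs_mx_scale _ _ pn0 pA pB) /rhs_mx divr1.
rewrite (mxpow1 iota (mxpow_psd iota p pB)).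
apply: log_majorization; [exact: mxpow_psd|exact: mxpow_psd|..].
- by rewrite ler_pdivlMr // mul1r.
- by rewrite divr_ge0 // ltW.
case: hpq => [h|[h1 h2]]; [left|right]; first by rewrite ler_pdivrMr.
move: h2; rewrite ler_pdivlMr ?subr_gt0 // => h2.
have -> : r / p * (q / p - 2) = r * (q - 2 * p) / p / p by field.
by rewrite ler_pM2r ?invr_gt0 // ler_pdivrMr // [q * p]mulrC.
Qed.

Definition pd n (A : 'M[C]_n) : Prop :=
  A \is hermsymmx /\ forall x, x != 0 -> 0 < qform A x.

Lemma spec_pdP n (U : 'M[C]_n) (d : 'rV[R]_n) : U \is unitarymx ->
  (forall i, 0 < d 0 i) -> pd (spec U d).
Proof.
move=> uU d0; split; last by move=> x; apply: spec_pd.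
by case: (spec_psd iota U (fun i => ltW (d0 i))).
Qed.

Lemma pd_psd n (A : 'M[C]_n) : pd A -> psd A.
Proof.
case=> hA pA; split=> // x; have [->|/pA/ltW//] := eqVneq x 0.
by rewrite /qform mulmx0 mxE.
Qed.

(** The p-th roots of the matrices found for p = 1. The factor 3 is the matrix size: it absorbs the
    gap between trace and top eigenvalue, so log-majorization fails too. *)
Lemma trace_counterexample_pqr (p q r : R) : 0 < p -> 2 * p < q ->
  p * q / (q - 2 * p) < r ->
  exists A B : 'M[C]_3, [/\ pd A, pd B &
    3 * \tr (lhs_mx q r A B) < \tr (rhs_mx p q r A B)].
Proof.
move=> p0 pq; rewrite ltr_pdivrMr ?subr_gt0 // => hr.
have pn0 := lt0r_neq0 p0.
have q2 : 2 < q / p by rewrite ltr_pdivlMr.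
have hr' : q / p < r / p * (q / p - 2).
  have -> : r / p * (q / p - 2) = r * (q - 2 * p) / p / p by field.
  by rewrite ltr_pM2r ?invr_gt0 // ltr_pdivlMr // mulrC.
have [U [V [d [e [uU uV d0 e0 h]]]]] := trace_counterexample iota q2 hr'.
have pU := spec_psd iota U (fun i => ltW (d0 i)).
have pV := spec_psd iota V (fun i => ltW (e0 i)).
pose A := mxpow (spec U d) p^-1; pose B := mxpow (spec V e) p^-1.
have pdpow (W : 'M[C]_3) (f : 'rV[R]_3) : W \is unitarymx ->
    (forall i, 0 < f 0 i) -> pd (mxpow (spec W f) p^-1).
  move=> uW f0; rewrite mxpow_spec // => [|i]; last exact: ltW.
  by apply: spec_pdP => // i; rewrite mxE powR_gt0.
have pA : pd A by apply: pdpow.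
have pB : pd B by apply: pdpow.
exists A, B; split=> //.
have eA : mxpow A p = spec U d by rewrite mxpow_mxpow // mulVf // mxpow1.
have eB : mxpow B p = spec V e by rewrite mxpow_mxpow // mulVf // mxpow1.
rewrite -(lhs_mx_scale _ _ pn0 (pd_psd pA) (pd_psd pB)).
rewrite -(rhs_mx_scale _ _ pn0 (pd_psd pA) (pd_psd pB)) eA eB.
by rewrite /rhs_mx divr1 (mxpow1 iota pV).
Qed.

Lemma trace_top_eig n (H : 'M[C]_n.+1) : psd H ->
  nth 0 (eigs H) 0 <= \tr H /\ \tr H <= n.+1%:R * nth 0 (eigs H) 0.
Proof.
move=> /(psd_decreasing iota)[U [d [uU d0 dd ->]]].
have -> : nth 0 (eigs (spec U d)) 0 = iota (d 0 ord0).
  have := eigs_prod iota uU dd (ltn0Sn n); rewrite big_ord_recl big_ord0 mulr1 => ->.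
  by rewrite (big_pred1 ord0) // => i; rewrite ltnS leqn0.
have -> : \tr (spec U d) = \sum_i iota (d 0 i).
  rewrite /spectral_mx -mulmxA mxtrace_mulC mulmxtVK // mxtrace_diag.
  by apply: eq_bigr => i _; rewrite mxE.
split; first by rewrite big_ord_recl lerDl sumr_ge0 // => i _; rewrite iota_ge0.
rewrite mulr_natl -[X in _ *+ X]card_ord -sumr_const.
by apply: ler_sum => i _; rewrite ler_embed dd.
Qed.

Lemma mul_trace_top_eig n (A B : 'M[C]_n.+1) s : psd A -> psd B -> 0 <= s ->
  nth 0 (eigs (mxpow A s *m B)) 0 <= \tr (mxpow A s *m B) /\
  \tr (mxpow A s *m B) <= n.+1%:R * nth 0 (eigs (mxpow A s *m B)) 0.
Proof.
move=> pA pB s0; have -> : mxpow A s = mxpow A (s / 2) *m mxpow A (s / 2).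
  by rewrite -mxpowD ?divr_ge0 //; congr mxpow; field.
rewrite -mulmxA eigs_mulC mxtrace_mulC; apply: trace_top_eig.
exact: psd_sandwich.
Qed.

Definition log_maj n (X Y : 'M[C]_n) : Prop :=
  (forall k : nat, (1 <= k < n)%N ->
     \prod_(j < k) nth 0 (eigs Y) j <= \prod_(j < k) nth 0 (eigs X) j) /\
  \det X = \det Y.

(** The parameter f is meant for [mxpowR]; its nested occurrences under binders then need no
    rewriting in the theorem. *)
Lemma log_majorization_iff (p q r : R)
    (f : forall n, 'M[C]_n -> R -> 'M[C]_n) :
  (forall n (A : 'M[C]_n) s, f n A s = mxpow A s) ->
  0 < p -> p <= q -> 0 <= r ->
  ((forall n : nat, (1 <= n)%N ->
      forall A B : 'M[C]_n, psd A -> psd B ->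
        log_maj
          (f n A (r + q) *m f n B q)
          (f n A r *m f n (f n A (p / 2) *m f n B p *m f n A (p / 2)) (q / p)))
   <->
   ((p <= q /\ q <= 2 * p) \/
    (2 * p < q /\ 0 <= r /\ r <= p * q / (q - 2 * p))))
  /\
  (2 * p < q -> p * q / (q - 2 * p) < r ->
   exists A B : 'M[C]_3,
     [/\ pd A, pd B &
       \tr (f 3%N A (r + q) *m f 3%N B q)
       < \tr (f 3%N A r *m
           f 3%N (f 3%N A (p / 2) *m f 3%N B p *m f 3%N A (p / 2)) (q / p))]).
Proof.
move=> fE p_gt0 le_pq r_ge0.
have el n (A B : 'M[C]_n) : f n A (r + q) *m f n B q = lhs_mx q r A B.
  by rewrite !fE.
have er n (A B : 'M[C]_n) :
    f n A r *m f n (f n A (p / 2) *m f n B p *m f n A (p / 2)) (q / p) =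
    rhs_mx p q r A B.
  by rewrite !fE.
have q_gt0 : 0 < q by exact: lt_le_trans le_pq.
split; last first.
  move=> pq hr.
  have [A [B [pA pB h]]] := trace_counterexample_pqr p_gt0 pq hr.
  exists A, B; rewrite el er; split=> //; apply: le_lt_trans h.
  have : 0 <= \tr (lhs_mx q r A B).
    by apply: (psd_mul_tr_ge0 iota); apply: mxpow_psd; apply: pd_psd.
  by move=> t0; rewrite -{1}[\tr _]mul1r ler_wpM2r // ler1n.
split=> [major|cond n _ A B pA pB]; last first.
  have hq : q <= 2 * p \/ 2 * p < q /\ r <= p * q / (q - 2 * p).
    by case: cond => [[_ ?]|[? [_ ?]]]; [left|right].
  rewrite el er.
  have [h1 h2] := log_majorization_pqr p_gt0 le_pq r_ge0 hq pA pB.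
  by split=> // k /andP[_ /ltnW/h1].
have [q2p|pq] := leP q (2 * p); first by left.
right; split=> //; split=> //; rewrite leNgt; apply/negP => hr.
have [A [B [pA pB h]]] := trace_counterexample_pqr p_gt0 pq hr.
have psdA := pd_psd pA; have psdB := pd_psd pB.
have [+ _] := major 3%N isT A B psdA psdB.
rewrite el er => /(_ 1%N isT); rewrite !big_ord1 => top.
have rq0 : 0 <= r + q by rewrite addr_ge0 // ltW.
have [hl _] := mul_trace_top_eig psdA (mxpow_psd iota q psdB) rq0.
have pX := psd_sandwich iota (p / 2) psdA (mxpow_psd iota p psdB).
have [_ hr'] := mul_trace_top_eig psdA (mxpow_psd iota (q / p) pX) r_ge0.
(* With L and M the two products and lambda the top eigenvalue: 3 tr L < tr M <= 3 lambda(M) <= 3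
   lambda(L) <= 3 tr L. *)
have := lt_le_trans h (le_trans hr' (ler_wpM2l (ler0n _ 3) (le_trans top hl))).
by rewrite ltxx.
Qed.

End Rescaling.

(** * Specialization to the complex numbers over R *)

Section Bridge.
Variable R : realType.
Local Open Scope complex_scope.

Lemma complex_reK : {in Num.real, cancel (@complex.Re R) (real_complex R)}.
Proof. by move=> z zr; rewrite RRe_real. Qed.

Definition complex_embedding : real_embedding R R[i] :=
  RealEmbedding (embed := real_complex R) (real_part := @complex.Re R)
    (fun=> erefl) complex_reK (@lecR R).

Lemma mxpowRE n (A : 'M[R[i]]_n) s : mxpowR A s = mxpow complex_embedding A s.
Proof. by rewrite mxpow.unlock. Qed.

End Bridge.

Local Open Scope complex_scope.

Theorem theorem5p1 (R : realType) (p q r : R)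
    (p_gt0 : 0 < p) (le_pq : p <= q) (r_ge0 : 0 <= r) :
  ((forall n : nat, (1 <= n)%N ->
      forall A B : 'M[R[i]]_n, psdmx A -> psdmx B ->
        log_major
          (mxpowR A (r + q) *m mxpowR B q)
          (mxpowR A r *m
             mxpowR (mxpowR A (p / 2) *m mxpowR B p *m mxpowR A (p / 2))
                    (q / p)))
   <->
   ((p <= q /\ q <= 2 * p) \/
    (2 * p < q /\ 0 <= r /\ r <= p * q / (q - 2 * p))))
  /\
  (2 * p < q -> p * q / (q - 2 * p) < r ->
   exists A B : 'M[R[i]]_3,
     [/\ pdmx A, pdmx B &
       (* Both traces are real; the strict inequality states that the reverse
          one fails without counting incomparable values as failures. *)
       \tr (mxpowR A (r + q) *m mxpowR B q)
       < \tr (mxpowR A r *m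
                mxpowR (mxpowR A (p / 2) *m mxpowR B p *m mxpowR A (p / 2))
                       (q / p))]).
Proof.
exact: (log_majorization_iff (@mxpowRE R) p_gt0 le_pq r_ge0).
Qed.
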